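(* Let $\Omega$ be an open set in $\mathbb{R}^n$ and let $f:\Omega\to\mathbb{R}$ be a locally Lipschitz function satisfying $$|\nabla f(x)|\leq V(x)\,|f(x)|\quad\text{for a.e. } x\in\Omega,$$ where $V\in L^n_{\mathrm{loc}}(\Omega)$. If there is a point $x_0\in\Omega$ such that $f(x_0)=0$, then $f\equiv 0$ in $\Omega$.
   Context: The gradient $\nabla f$ of a locally Lipschitz function exists almost everywhere by Rademacher's theorem, and $|\nabla f|$ is its Euclidean norm.
   Formalization: The open set Ω is additionally assumed connected; without this the claim is false: on a disconnected Ω take f = 0 on one component, f = 1 on the others, and V = 0. *)

(* Defs.v *)
From HB Require Import structures.
From mathcomp Require Import all_boot all_order all_algebra.
From mathcomp Require Import all_classical all_reals all_analysis.

Set Implicit Arguments.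
Unset Strict Implicit.
Unset Printing Implicit Defensive.

Import Order.TTheory GRing.Theory Num.Theory.
Import numFieldNormedType.Exports.

Local Open Scope classical_set_scope.
Local Open Scope ring_scope.

(* R^n is 'rV[R]_n. The library norm of 'rV[R]_n is the sup norm, which induces
   the usual topology; the Euclidean norm is [enorm] below. *)

(* The product sigma-algebra on 'rV[T]_n, as the library does for n.-tuple T;
   for T = R it is the Borel sigma-algebra of R^n. *)
Section measurable_rV.
Context {d} {T : sigmaRingType d}.
Variable n : nat.

Let coors : 'I_n -> 'rV[T]_n -> T := fun i x => x ord0 i.

Let rV_set0 : g_sigma_preimage coors set0.
Proof. exact: sigma_algebra0. Qed.

Let rV_setC A : g_sigma_preimage coors A -> g_sigma_preimage coors (~` A).
Proof. exact: sigma_algebraC. Qed.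

Let rV_bigcup (F : _^nat) : (forall i, g_sigma_preimage coors (F i)) ->
  g_sigma_preimage coors (\bigcup_i (F i)).
Proof. exact: sigma_algebra_bigcup. Qed.

HB.instance Definition _ := @isMeasurable.Build (measure_tuple_display d)
  'rV[T]_n (g_sigma_preimage coors) rV_set0 rV_setC rV_bigcup.

End measurable_rV.

Lemma measurable_coord_rV d (T : sigmaRingType d) n (i : 'I_n) :
  measurable_fun [set: 'rV[T]_n] (fun x => x ord0 i).
Proof.
move=> _ Y mY; rewrite setTI; apply: sub_sigma_algebra => /=.
rewrite -bigcup_seq/=; exists i => /=; first by rewrite mem_index_enum.
by exists Y => //; rewrite setTI.
Qed.

Lemma measurable_fun_rVP d1 d2 (T1 : measurableType d1)
    (T2 : measurableType d2) n (f : T1 -> 'rV[T2]_n) :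
  (forall i, measurable_fun [set: T1] (fun t => f t ord0 i)) ->
  measurable_fun [set: T1] f.
Proof.
move=> mf _ A mA; rewrite setTI.
have : (<<s \big[setU/set0]_(i < n)
    preimage_set_system setT (fun x : 'rV[T2]_n => x ord0 i) measurable >>)
    `<=` [set B | measurable (f @^-1` B)].
  apply: smallest_sub.
    split => /=.
    - by rewrite preimage_set0.
    - by move=> B mB; rewrite setTD -preimage_setC; exact: measurableC.
    - by move=> F mF; rewrite preimage_bigcup; exact: bigcup_measurable.
  move=> B; rewrite -bigcup_seq => -[i _ [C mC <-]] /=.
  by rewrite setTI; have := mf i measurableT C mC; rewrite setTI.
exact.
Qed.

Section lebesgue_measure_rV.
Variable R : realType.

Definition cons_rV n (p : measurableTypeR R * 'rV[R]_n) : 'rV[R]_n.+1 :=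
  row_mx (const_mx p.1 : 'rV[R]_1) p.2.

Definition uncons_rV n (x : 'rV[R]_n.+1) : measurableTypeR R * 'rV[R]_n :=
  (x ord0 ord0, \row_i x ord0 (lift ord0 i)).

Lemma cons_rV0 n (p : measurableTypeR R * 'rV[R]_n) : cons_rV p ord0 ord0 = p.1.
Proof.
rewrite /cons_rV (_ : ord0 = lshift n (ord0 : 'I_1)); last exact: val_inj.
by rewrite (row_mxEl (const_mx p.1 : 'rV[R]_1)) mxE.
Qed.

Lemma cons_rVS n (p : measurableTypeR R * 'rV[R]_n) (i : 'I_n) :
  cons_rV p ord0 (lift ord0 i) = p.2 ord0 i.
Proof.
rewrite /cons_rV (_ : lift ord0 i = rshift 1 i); last exact: val_inj.
by rewrite (row_mxEr (const_mx p.1 : 'rV[R]_1)).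
Qed.

Lemma uncons_rVK n : cancel (@uncons_rV n) (@cons_rV n).
Proof.
move=> x; apply/rowP => i; case: (unliftP ord0 i) => [j|] ->.
  by rewrite cons_rVS mxE.
by rewrite cons_rV0.
Qed.

Lemma cons_rVK n : cancel (@cons_rV n) (@uncons_rV n).
Proof.
move=> [a x]; rewrite /uncons_rV cons_rV0; congr pair.
by apply/rowP => i; rewrite mxE cons_rVS.
Qed.

Lemma measurable_cons_rV n : measurable_fun setT (@cons_rV n).
Proof.
apply: measurable_fun_rVP => i; case: (unliftP ord0 i) => [j|] ->.
  apply: (eq_measurable_fun (fun p : measurableTypeR R * 'rV[R]_n => p.2 ord0 j)).
    by move=> p _; rewrite cons_rVS.
  apply: (measurableT_comp (f := fun x : 'rV[R]_n => x ord0 j)) => //.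
  exact: measurable_coord_rV.
apply: (eq_measurable_fun (@fst (measurableTypeR R) 'rV[R]_n)) => //.
by move=> p _; rewrite cons_rV0.
Qed.

Lemma measurable_uncons_rV n : measurable_fun setT (@uncons_rV n).
Proof.
apply/measurable_fun_pairP; split; first exact: measurable_coord_rV.
apply: measurable_fun_rVP => i.
apply: (eq_measurable_fun (fun x : 'rV[R]_n.+1 => x ord0 (lift ord0 i))).
  by move=> x _ /=; rewrite mxE.
exact: measurable_coord_rV.
Qed.

Section cons_measure.
Variables (n : nat)
  (m1 : {sigma_finite_measure set (measurableTypeR R) -> \bar R})
  (mu : {sigma_finite_measure set 'rV[R]_n -> \bar R}).

(* The product measure of m1 and mu, carried to 'rV[R]_n.+1. *)
Definition cons_measure : set 'rV[R]_n.+1 -> \bar R :=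
  pushforward (m1 \x mu)%E (@cons_rV n).

Let measurable_preimage_cons (A : set 'rV[R]_n.+1) :
  measurable A -> measurable (@cons_rV n @^-1` A).
Proof.
by move=> mA; rewrite -[X in measurable X]setTI; exact: measurable_cons_rV.
Qed.

Let cons_measure0 : cons_measure set0 = 0%E.
Proof. by rewrite /cons_measure /pushforward preimage_set0 measure0. Qed.

Let cons_measure_ge0 A : (0 <= cons_measure A)%E.
Proof. by rewrite /cons_measure /pushforward measure_ge0. Qed.

Let cons_measure_sigma_additive : semi_sigma_additive cons_measure.
Proof.
move=> F mF tF mUF; rewrite /cons_measure /pushforward preimage_bigcup.
apply: measure_semi_sigma_additive.
- by move=> k; exact: measurable_preimage_cons.
- apply/trivIsetP => /= i j _ _ ij; rewrite -preimage_setI.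
  by move/trivIsetP : tF => /(_ _ _ _ _ ij) ->//; rewrite preimage_set0.
- by rewrite -preimage_bigcup; exact: measurable_preimage_cons.
Qed.

HB.instance Definition _ := isMeasure.Build _ _ _ cons_measure
  cons_measure0 cons_measure_ge0 cons_measure_sigma_additive.

Let cons_measure_sigma_finite : sigma_finite setT cons_measure.
Proof.
have /sigma_finiteP[F [TF ndF Foo]] := sigma_finiteT m1.
have /sigma_finiteP[G [TG ndG Goo]] := sigma_finiteT mu.
exists (fun k => @uncons_rV n @^-1` (F k `*` G k)).
  rewrite -preimage_bigcup (_ : \bigcup_k _ = setT) ?preimage_setT//.
  rewrite -setXTT TF TG predeqE => -[x y]; split.
    by move=> [k _ []/= ? ?]; split; exists k.
  move=> [/= [k _ Fkx] [l _ Gly]]; exists (maxn k l) => //; split.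
  - by move: x Fkx; exact/subsetPset/ndF/leq_maxl.
  - by move: y Gly; exact/subsetPset/ndG/leq_maxr.
move=> k; have [mF Fkoo] := Foo k; have [mG Gkoo] := Goo k; split.
  rewrite -[X in measurable X]setTI; apply: measurable_uncons_rV => //.
  exact: measurableX.
rewrite /cons_measure /pushforward.
rewrite (_ : _ @^-1` _ = F k `*` G k).
  by rewrite product_measure1E// lte_mul_pinfty// ge0_fin_numE.
by apply/seteqP; split => p; rewrite /preimage /mkset cons_rVK.
Qed.

HB.instance Definition _ := Measure_isSigmaFinite.Build _ _ _ cons_measure
  cons_measure_sigma_finite.

End cons_measure.

Fixpoint lebesgue_rV n : {sigma_finite_measure set 'rV[R]_n -> \bar R} :=
  match n with
  | 0 => \d_ (0 : 'rV[R]_0)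
  | m.+1 => cons_measure lebesgue_measure (lebesgue_rV m)
  end.

Lemma lebesgue_rV_box n (A : 'I_n -> set R) :
  (forall i, measurable (A i)) ->
  lebesgue_rV n [set x | forall i, A i (x ord0 i)] =
  (\prod_(i < n) lebesgue_measure (A i))%E.
Proof.
elim: n A => [|n IH] A mA.
  rewrite big_ord0 /= diracE mem_set//=.
  by case.
have mbox : measurable [set x : 'rV[R]_n | forall i, A (lift ord0 i) (x ord0 i)].
  rewrite (_ : mkset _ = \bigcap_(i in [set: 'I_n])
      (fun x : 'rV[R]_n => x ord0 i) @^-1` A (lift ord0 i)).
    apply: fin_bigcap_measurable => // i _.
    by rewrite -[X in measurable X]setTI; exact: measurable_coord_rV.
  by apply/seteqP; split => [x /= + i _|x /= + i]; apply.
rewrite big_ord_recl -IH// -product_measure1E//= /cons_measure /pushforward.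
congr (_ _); apply/seteqP; split=> p /=.
  move=> Ap; split; first by have := Ap ord0; rewrite cons_rV0.
  by move=> i; have := Ap (lift ord0 i); rewrite cons_rVS.
move=> [A0 AS] i; case: (unliftP ord0 i) => [j|] ->.
  by rewrite cons_rVS.
by rewrite cons_rV0.
exact: mA.
Qed.

Section functions.
Variable n : nat.
Implicit Types (D : set 'rV[R]_n) (f V : 'rV[R]_n -> R).

Definition enorm (x : 'rV[R]_n) : R := Num.sqrt (\sum_(i < n) x ord0 i ^+ 2).

(* The vector of partial derivatives. Where a partial derivative does not exist,
   'D takes a default value; for a locally Lipschitz function this only happens
   on a null set, by Rademacher's theorem. *)
Definition gradient f (x : 'rV[R]_n) : 'rV[R]_n :=
  \row_i 'D_(delta_mx ord0 i) f x.

Definition locally_lipschitz D f := forall x, D x ->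
  exists2 U, nbhs x U & [lipschitz f y | y in U `&` D].

(* L^p_loc(D): on every compact subset of D, V agrees almost everywhere with a
   function in L^p. The functions in [Lfun] are Borel measurable; passing to an
   a.e. equal one allows for V Lebesgue measurable. *)
Definition Lloc (p : \bar R) D V := forall K, compact K -> K `<=` D ->
  exists2 g, g \in Lfun (lebesgue_rV n) p &
    {ae lebesgue_rV n, forall x, K x -> V x = g x}.

End functions.
End lebesgue_measure_rV.

Arguments lebesgue_rV {R} n.

(* Main.v *)
(* On a cube where f is Lipschitz and f x0 = 0, the functions
   u_d = - ln (f^2 + d^2) / 2 satisfy |grad u_d| <= V uniformly in d > 0.
   Changing one coordinate at a time, the averages of u_d over two boxes inside
   a cube Q, with all sides comparable to the side s of Q, differ by at most a
   constant times s^(1-n) times the integral of V over Q, which Hoelder's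
   inequality bounds by the L^n norm of V on Q.  On small cubes this norm is small, so that the averages over
   the dyadic cubes Q_k of side 2^-k around x0 grow by at most (ln 2)/2 per step.
   But if d is comparable to 2^-k, then u_d >= k ln 2 - C on Q_k.  Hence
   the averages over Q_0 cannot stay bounded as d -> 0, which they would do if
   f were nonzero somewhere in Q_0.  So f vanishes near each of its
   zeros, and connectedness concludes.

   The one-dimensional ingredient (a Lipschitz function is the integral of its
   almost everywhere existing derivative) comes from the Radon-Nikodym density
   of a Stieltjes measure and Lebesgue's differentiation theorem. *)

From HB Require Import structures.
Require Import Defs.
From mathcomp Require Import all_boot all_order all_algebra.
From mathcomp Require Import all_classical all_reals all_analysis.
From mathcomp Require Import measurable_realfun ring lra.

Set Implicit Arguments.
Unset Strict Implicit.
Unset Printing Implicit Defensive.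

Import Order.TTheory GRing.Theory Num.Theory.
Import numFieldNormedType.Exports.

Local Open Scope classical_set_scope.
Local Open Scope ring_scope.

(** * Lipschitz functions of one real variable *)

Section lipschitz_one_variable.
Context {R : realType}.
Notation mu := (@lebesgue_measure R).

(* The Stieltjes measures of v and of C x - v add up to C times the Lebesgue
   measure, so that both are absolutely continuous. *)
Lemma two_sided_cumulative_density (v : R -> R) (C a b : R) : 0 < C ->
  {homo v : x y / x <= y} -> {homo (fun x => C * x - v x) : x y / x <= y} ->
  a < b ->
  exists2 h : R -> R, measurable_fun setT h /\ (forall x, 0 <= h x) &
    (forall x, a <= x <= b ->
       (v x - v a)%:E = (\int[mu]_(t in `]a, x]) (h t)%:E)%E) /\
    {ae mu, forall x, a < x < b -> is_derive x 1 v (h x)}.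
Proof.
move=> C0 ndv ndw ab; pose w x := C * x - v x.
have vlip x y : x <= y -> 0 <= v y - v x <= C * (y - x).
  move=> xy; rewrite subr_ge0 ndv//=.
  have := ndw _ _ xy; rewrite mulrBr; lra.
have cv : continuous v.
  move=> x; apply/cvgrPdist_le => e e0.
  near=> y.
  have yx : `|x - y| <= e / C.
    by near: y; apply: cvgr_dist_le => //; rewrite divr_gt0.
  move: yx; rewrite ler_pdivlMr// => yx.
  case: (leP x y) => [/[dup] xy /vlip|/ltW/[dup] xy /vlip] => [h|h].
    rewrite ler0_norm in yx; last by lra.
    by rewrite ler0_norm; lra.
  rewrite ger0_norm in yx; last by lra.
  by rewrite ger0_norm; lra.
have cw : continuous w.
  move=> x; apply: cvgB; last exact: cv.
  by apply: cvgM; [exact: cvg_cst|exact: cvg_id].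
pose Hv := isCumulative.Build R _ R v ndv (right_continuousW cv).
pose Hw := isCumulative.Build R _ R w ndw (right_continuousW cw).
pose cumv : cumulative R R := HB.pack v Hv.
pose cumw : cumulative R R := HB.pack w Hw.
pose mv := lebesgue_stieltjes_measure cumv.
pose mw := lebesgue_stieltjes_measure cumw.
have Ci0 : 0 <= C^-1 by rewrite invr_ge0 ltW.
pose m : {measure set (measurableTypeR R) -> \bar R} :=
  mscale (NngNum Ci0) (measure_add mv mw).
have mmE A : m A = (C^-1%:E * (mv A + mw A))%E.
  by rewrite -(measure_addE mv mw).
have itvE (f : cumulative R R) x y : x <= y ->
    lebesgue_stieltjes_measure f `]x, y] = (f y - f x)%:E.
  move=> xy; rewrite /lebesgue_stieltjes_measure/measure_extension/=.
  by rewrite measurable_mu_extE/=; [exact: wlength_itv_bnd|exact: is_ocitv].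
have mE A : measurable A -> mu A = m A.
  apply: lebesgue_measure_unique => _ [[x y] _ <-] /=.
  have [yx|xy] := leP y x.
    by rewrite set_itv_ge ?bnd_simp -?leNgt// !measure0.
  rewrite mmE /mv /mw !itvE ?ltW//.
  rewrite lebesgue_measure_itv/= lte_fin xy -!EFinD -EFinM; congr EFin.
  by rewrite /= /w; field; rewrite gt_eqF.
have mv0 A : measurable A -> mu A = 0%E -> mv A = 0%E.
  move=> mA; rewrite mE// mmE => /eqP.
  rewrite mule_eq0/= eqe invr_eq0 gt_eqF//= padde_eq0//.
  by move=> /andP[/eqP ].
have mD : measurable (`]a, b]%classic : set (measurableTypeR R)) by [].
have Doo : (mv `]a, b]%classic < +oo)%E by rewrite /mv itvE ?ltW// ltry.
(* Restricting to ]a, b] makes the measure finite, as the Radon-Nikodym theorem requires. *)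
pose nu : {finite_measure set (measurableTypeR R) -> \bar R} := mfrestr mD Doo.
have numu : nu `<< mu.
  apply/null_content_dominatesP => A mA A0.
  apply/eqP; rewrite eq_le measure_ge0 andbT.
  rewrite -(mv0 _ mA A0) /nu/= /mfrestr/= /mrestr.
  by rewrite le_measure// ?inE//; exact: measurableI.
pose h0 := Radon_Nikodym_SigmaFinite.f nu mu.
have h0fin x : h0 x \is a fin_num by exact: Radon_Nikodym_SigmaFinite.f_fin_num.
have h0ge0 x : (0 <= h0 x)%E by exact: Radon_Nikodym_SigmaFinite.f_ge0.
have ih0 : mu.-integrable setT h0.
  exact: Radon_Nikodym_SigmaFinite.f_integrable.
pose h x := fine (h0 x).
have hE : EFin \o h = h0 by apply/funext => x /=; rewrite fineK.
have ih : mu.-integrable setT (EFin \o h) by rewrite hE.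
have hint x : a <= x <= b ->
    ((v x - v a)%:E = \int[mu]_(t in `]a, x]) (h t)%:E)%E.
  move=> /andP[ax xb].
  rewrite -(itvE cumv)// -/mv.
  transitivity (nu `]a, x]%classic).
    rewrite /nu/= /mfrestr/= /mrestr setIidl//.
    by apply: subset_itvl; rewrite bnd_simp.
  rewrite (Radon_Nikodym_SigmaFinite.f_integral numu)//.
  by rewrite -/h0 -hE.
exists h.
  split; last by move=> x; rewrite fine_ge0.
  by apply/measurable_EFinP; rewrite hE; exact: measurable_int ih0.
split=> //.
have ihy y : mu.-integrable [set` Interval (BRight a) (BRight y)] (EFin \o h).
  by apply: integrableS ih.
have := @FTC1 R h (BRight a) ihy
  (open_integrable_locally openT ih).
apply: filterS; first exact: (ae_filter_ringOfSetsType mu).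
move=> x Fx /andP[ax xb].
have [|dF F'] := Fx; first by rewrite lte_fin.
have {}dF : is_derive x 1 (fun y => v a + (\int[mu]_(t in `]a, y]) h t)%R) (h x).
  rewrite -[h x]add0r; apply: is_deriveD.
  by apply: DeriveDef; [exact: dF|rewrite -derive1E].
apply: near_eq_is_derive dF.
near=> y.
have ay : a <= y by near: y; apply: filterS (lt_nbhsr ax) => z /ltW.
have yb : y <= b by near: y; apply: filterS (lt_nbhsl xb) => z /ltW.
by rewrite /Rintegral -hint ?ay//=; ring.
Unshelve. all: by end_near. Qed.

(* h is the density of the nondecreasing function psi + K x. *)
Lemma lipschitz_density (psi : R -> R) (L a b : R) : a < b ->
  (forall x y, a <= x <= b -> a <= y <= b ->
    `|psi x - psi y| <= L * `|x - y|) ->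
  exists (h : R -> R) (K : R), [/\ measurable_fun setT h,
    forall x, 0 <= h x, 0 <= K,
    (psi b - psi a + K * (b - a))%:E = (\int[mu]_(t in `]a, b]) (h t)%:E)%E &
    {ae mu, forall t, a < t < b -> is_derive t 1 psi (h t - K)}].
Proof.
move=> ab lip.
have L0 : 0 <= L.
  have := lip b a; rewrite !lexx (ltW ab)/= => /(_ isT isT).
  move=> /(le_trans (normr_ge0 _)).
  by rewrite pmulr_lge0// normr_gt0 subr_eq0 gt_eqF.
(* Taking [K] larger than [L] keeps the constant 2K positive even when [L] is 0. *)
pose K := L + 1.
(* Composing with the projection onto [a, b] extends [psi] by constants, so that the monotonicity of
   [v] and of 2Kx - v x holds on the whole line. *)
pose clip x := Num.max a (Num.min b x).
have clipin x : a <= clip x <= b.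
  by rewrite /clip le_max lexx ge_max (ltW ab) ge_min lexx.
have clipid x : a <= x <= b -> clip x = x.
  by move=> /andP[ax xb]; rewrite /clip (min_idPr xb) (max_idPr ax).
have clipd x y : x <= y -> 0 <= clip y - clip x <= y - x.
  move=> xy; rewrite /clip !maxElt !minElt.
  by case: (ltP b x) => ?; case: (ltP b y) => ?; case: ltP => ?; case: ltP => ?;
    apply/andP; split; lra.
have lipc x y : x <= y -> `|psi (clip y) - psi (clip x)| <= L * (y - x).
  move=> xy; have /andP[h1 h2] := clipd _ _ xy.
  apply: le_trans (lip _ _ (clipin _) (clipin _)) _.
  by rewrite ger0_norm// ler_wpM2l.
pose v x := psi (clip x) + K * x.
have K0 : 0 < K *+ 2 by rewrite /K mulr2n; lra.
have [||||h [mh h0] [hE hD]] := @two_sided_cumulative_density v (K *+ 2) a b.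
- exact: K0.
- move=> x y xy; have := lipc _ _ xy; rewrite ler_norml => /andP[h1 h2].
  by rewrite /v /K; nra.
- move=> x y xy; have := lipc _ _ xy; rewrite ler_norml => /andP[h1 h2].
  by rewrite /v /K mulr2n; nra.
- exact: ab.
exists h, K; split => //.
- by rewrite /K; lra.
- rewrite -hE ?lexx ?(ltW ab)// /v !clipid ?lexx ?(ltW ab)//.
  by congr EFin; ring.
move: hD; apply: filterS; first exact: (ae_filter_ringOfSetsType mu).
move=> t ht abt; have vt := ht abt.
apply: (@near_eq_is_derive _ _ _ (fun x => v x - K * x)).
  move: abt => /andP[at' tb]; near=> y.
  rewrite /v clipid ?addrK//.
  apply/andP; split.
    by near: y; apply: filterS (lt_nbhsr at') => z /ltW.
  by near: y; apply: filterS (lt_nbhsl tb) => z /ltW.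
apply: is_deriveB.
by apply: is_derive_eq; rewrite /GRing.scale/= mulr1.
Unshelve. all: by end_near. Qed.

(** Rademacher's theorem in one variable. On slices it ensures that the partial derivatives entering
    [gradient] are genuine at almost every point. *)
Lemma lipschitz_ae_derivable (psi : R -> R) (L a b : R) : a < b ->
  (forall x y, a <= x <= b -> a <= y <= b ->
    `|psi x - psi y| <= L * `|x - y|) ->
  {ae mu, forall t, a < t < b -> derivable psi t 1}.
Proof.
move=> ab /(lipschitz_density ab)[h [K [_ _ _ _]]].
apply: filterS; first exact: (ae_filter_ringOfSetsType mu).
by move=> t dt /dt [].
Qed.

(** The derivative of [psi] is [h - K] almost everywhere, so [h <= g + K]. Both sides are
    nonnegative, so their integrals compare even if that of [g] is infinite, and K(b - a) is then
    subtracted. *)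
Lemma lipschitz_increment_le_integral (psi g : R -> R) (L a b : R) : a < b ->
  (forall x y, a <= x <= b -> a <= y <= b ->
    `|psi x - psi y| <= L * `|x - y|) ->
  measurable_fun setT g -> (forall x, 0 <= g x) ->
  {ae mu, forall t, a < t < b -> derivable psi t 1 -> `|'D_1 psi t| <= g t} ->
  ((psi b - psi a)%:E <= \int[mu]_(t in `]a, b]) (g t)%:E)%E.
Proof.
move=> ab lip mg g0 aeg.
have [h [K [mh h0 K0 hE hD]]] := lipschitz_density ab lip.
have aeh : {ae mu, forall t, a < t < b -> h t <= g t + K}.
  move: hD aeg; apply: filterS2; first exact: (ae_filter_ringOfSetsType mu).
  move=> t ht gt abt; have dv := ht abt.
  have := gt abt (@ex_derive _ _ _ _ _ _ _ dv).
  rewrite (@derive_val _ _ _ _ _ _ _ dv) ler_norml => /andP[_ ].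
  by rewrite lerBlDr.
have mI : measurable (`]a, b]%classic : set (measurableTypeR R)) by [].
have : ((psi b - psi a + K * (b - a))%:E <=
    \int[mu]_(t in `]a, b]) (g t + K)%:E)%E.
  rewrite hE; apply: ae_ge0_le_integral => //.
  - by move=> x _; rewrite lee_fin.
  - by apply/measurable_EFinP; exact: measurable_funTS.
  - by move=> x _; rewrite lee_fin addr_ge0.
  - apply/measurable_EFinP; apply: measurable_funD => //.
    exact: measurable_funTS.
  (* The derivative bound is known on the open interval only; the endpoint [b] of ]a, b] is a null
     set. *)
  have bae : {ae mu, forall t, t != b}.
    exists [set b]; split => //=; first exact: lebesgue_measure_set1.
    by move=> t /= /negP; rewrite negbK => /eqP.
  move: bae aeh; apply: filterS2; first exact: (ae_filter_ringOfSetsType mu).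
  move=> t tb ht /=; rewrite in_itv/= => /andP[at' tb'].
  by rewrite lee_fin ht// at'/= lt_neqAle tb.
under eq_integral do rewrite EFinD.
rewrite ge0_integralD//=; last 2 first.
- by move=> x _; rewrite lee_fin.
- by apply/measurable_EFinP; exact: measurable_funTS.
have muI : mu `]a, b]%classic = (b - a)%:E.
  by rewrite lebesgue_measure_itv/= lte_fin ab.
have -> : (\int[mu]_(t in `]a, b]) K%:E = (K * (b - a))%:E)%E.
  by rewrite [LHS](integral_cst mu mI K%:E) EFinM; congr (_ * _)%E.
rewrite -leeBlDr// -EFinB.
by apply: le_trans; rewrite lee_fin; lra.
Qed.

(** Integrating over all of [a, b] makes the bound independent of [s] and [t], so that it can later
    be averaged over both. When t < s, the increment bound is applied to [- psi]. *)
Lemma lipschitz_dist_le_integral (psi g : R -> R) (L a b : R) :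
  (forall x y, a <= x <= b -> a <= y <= b ->
    `|psi x - psi y| <= L * `|x - y|) ->
  measurable_fun setT g -> (forall x, 0 <= g x) ->
  {ae mu, forall t, a < t < b -> derivable psi t 1 -> `|'D_1 psi t| <= g t} ->
  forall s t, a <= s <= b -> a <= t <= b ->
  ((psi t - psi s)%:E <= \int[mu]_(t in `[a, b]) (g t)%:E)%E.
Proof.
move=> lip mg g0 aeg s t /andP[as' sb] /andP[at' tb].
have sub x y : a <= x -> y <= b -> (\int[mu]_(t in `]x, y]) (g t)%:E <=
    \int[mu]_(t in `[a, b]) (g t)%:E)%E.
  move=> ax yb; apply: ge0_subset_integral => //.
  - by apply/measurable_EFinP; exact: measurable_funTS.
  - by move=> z _; rewrite lee_fin.
  - by apply: subset_itv; rewrite bnd_simp.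
have [st|ts|->] := ltgtP s t; last first.
- by rewrite subrr integral_ge0// => x _; rewrite lee_fin.
- apply: le_trans (sub t s at' sb).
  rewrite -[psi t - psi s]opprB opprD.
  apply: (@lipschitz_increment_le_integral (fun x => - psi x) g L) => //.
    move=> x y /andP[ax xb] /andP[ay yb].
    rewrite -opprD normrN lip ?(le_trans at' ax) ?(le_trans at' ay)//=.
      by rewrite (le_trans xb sb).
    by rewrite (le_trans yb sb).
  apply: filterS aeg; first exact: (ae_filter_ringOfSetsType mu).
  move=> x H /andP[tx xs] /derivableN; rewrite opprK => d.
  have -> : 'D_1 (\- psi) x = - 'D_1 psi x by rewrite deriveN.
  by rewrite normrN H// (le_lt_trans at' tx) (lt_le_trans xs sb).
- apply: le_trans (sub s t as' tb).
  apply: (@lipschitz_increment_le_integral psi g L) => //.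
    move=> x y /andP[ax xb] /andP[ay yb].
    rewrite lip ?(le_trans as' ax) ?(le_trans as' ay)//=.
      by rewrite (le_trans xb tb).
    by rewrite (le_trans yb tb).
  apply: filterS aeg; first exact: (ae_filter_ringOfSetsType mu).
  move=> x H /andP[tx xs]; apply: H.
  by rewrite (le_lt_trans as' tx) (lt_le_trans xs tb).
Qed.

End lipschitz_one_variable.

(** * Averages over boxes *)

Section box_averages.
Context {R : realType}.
Notation mu := (@lebesgue_measure R).
Implicit Types n : nat.

(** * Product sets and measurability in R^n *)

Definition prod_set n (A : 'I_n -> set R) : set 'rV[R]_n :=
  [set x | forall i, A i (x ord0 i)].

Lemma measurable_prod_set n (A : 'I_n -> set R) :
  (forall i, measurable (A i)) -> measurable (prod_set A).
Proof.
move=> mA.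
rewrite (_ : prod_set A = \bigcap_(i in [set: 'I_n])
    (fun x : 'rV[R]_n => x ord0 i) @^-1` A i).
  apply: fin_bigcap_measurable => // i _.
  by rewrite -[X in measurable X]setTI; exact: measurable_coord_rV.
by apply/seteqP; split => [x /= + i _|x /= + i]; apply.
Qed.

Lemma measurable_ball_rV n (x : 'rV[R]_n) (e : R) : measurable (ball x e).
Proof.
(* For e <= 0 the ball is empty, whereas in dimension 0 the product of empty balls is the whole
   space. *)
have [e0|e0] := leP e 0.
  rewrite (_ : ball x e = set0) // -subset0 => y [].
  by rewrite ltNge e0.
rewrite (_ : ball x e = prod_set (fun i => ball (x ord0 i) e)).
  by apply: measurable_prod_set => i; exact: measurable_ball.
apply/seteqP; split => y; first by move=> [_ +] i; apply.
by move=> xy; split => // i j; rewrite (ord1 i); exact: xy.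
Qed.

(** This links the sup-norm topology to the product sigma-algebra: an open set is the union of the
    countably many balls with rational centre and radius 1/(k+1) that it contains. *)
Lemma open_measurable_rV n (U : set 'rV[R]_n) : open U -> measurable U.
Proof.
move=> oU.
pose B (p : 'rV[rat]_n * nat) : set 'rV[R]_n :=
  ball (map_mx ratr p.1 : 'rV[R]_n) (p.2.+1%:R^-1).
pose F m : set 'rV[R]_n :=
  if unpickle m is Some p then if `[< B p `<=` U >] then B p else set0
  else set0.
rewrite (_ : U = \bigcup_m F m).
  apply: bigcupT_measurable => m; rewrite /F.
  case: unpickle => // p; case: ifP => // _; exact: measurable_ball_rV.
apply/seteqP; split => [x Ux|x [m _]]; last first.
  by rewrite /F; case: unpickle => // p; case: ifPn => // /asboolP; apply.
have /nbhs_ballP[e /= e0 xeU] : nbhs x U by exact: open_nbhs_nbhs.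
have [k ke] : exists k : nat, k.+1%:R^-1 < e / 2.
  have [k _ /(_ k)] := near_infty_natSinv_lt (PosNum (divr_gt0 e0 (ltr0n R 2))).
  by move=> /(_ (leqnn _)); exists k.
have k0 : (0:R) < k.+1%:R^-1 by rewrite invr_gt0.
have /choice[q qP] : forall i, exists q : rat,
    ball (x ord0 i) k.+1%:R^-1 (ratr q : R).
  move=> i; have [|q] :=
    @rat_in_itvoo R (x ord0 i - k.+1%:R^-1) (x ord0 i + k.+1%:R^-1).
    by rewrite ltrBlDr -addrA ltrDl addr_gt0.
  rewrite in_itv/= => /andP[h1 h2]; exists q; apply: ball_sym; rewrite /ball/=.
  by rewrite ltr_distl h1 h2.
pose p := (\row_i q i, k).
have Bx : B p x.
  split => // i j; rewrite (ord1 i) /p/= !mxE; exact/ball_sym.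
have BU : B p `<=` U.
  move=> y By; apply: xeU => /=; rewrite [e]splitr.
  by apply: ball_triangle (ball_sym (le_ball (ltW ke) Bx)) (le_ball (ltW ke) By).
exists (pickle p) => //.
by rewrite /F pickleK ifT//; exact/asboolP.
Qed.

Lemma continuous_measurable_rV n (U : set 'rV[R]_n) (f : 'rV[R]_n -> R) :
  open U -> {in U, continuous f} -> measurable_fun U f.
Proof.
move=> oU cf; apply: (measurability _ (RGenOInfty.measurableE R)).
move=> _ [_ [a ->] <-]; apply: open_measurable_rV; rewrite openE.
move=> x [Ux /= fxa]; apply: filterI; first exact: open_nbhs_nbhs.
apply: cf; first by rewrite inE.
by apply: open_nbhs_nbhs; split => //; exact: open_itv.
Qed.

(** * Slicing along an arbitrary coordinate *)

(** The analogue of [cons_rV] with the new coordinate at position [i]: [lebesgue_rV] is built along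
    the first axis, but Fubini is needed along every axis. *)
Definition insert_rV n (i : 'I_n.+1) (p : measurableTypeR R * 'rV[R]_n) :
    'rV[R]_n.+1 :=
  \row_j if unlift i j is Some k then p.2 ord0 k else p.1.

Lemma insert_rV_eq n (i : 'I_n.+1) p : insert_rV i p ord0 i = p.1.
Proof. by rewrite mxE unlift_none. Qed.

Lemma insert_rV_lift n (i : 'I_n.+1) j p :
  insert_rV i p ord0 (lift i j) = p.2 ord0 j.
Proof. by rewrite mxE liftK. Qed.

Lemma measurable_insert_rV n (i : 'I_n.+1) : measurable_fun setT (insert_rV i).
Proof.
apply: measurable_fun_rVP => j; case: (unliftP i j) => [k|] ->.
  apply: (eq_measurable_fun (fun p : measurableTypeR R * 'rV[R]_n => p.2 ord0 k)).
    by move=> p _; rewrite insert_rV_lift.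
  apply: (measurableT_comp (f := fun x : 'rV[R]_n => x ord0 k)) => //.
  exact: measurable_coord_rV.
apply: (eq_measurable_fun (@fst (measurableTypeR R) 'rV[R]_n)) => //.
by move=> p _; rewrite insert_rV_eq.
Qed.

Lemma insert_rV_prod_set n (i : 'I_n.+1) (A : 'I_n.+1 -> set R) :
  insert_rV i @^-1` prod_set A = A i `*` prod_set (fun j => A (lift i j)).
Proof.
apply/seteqP; split => [p Ap|p [/= A0 AS] j].
  split; first by have := Ap i; rewrite insert_rV_eq.
  by move=> j; have := Ap (lift i j); rewrite insert_rV_lift.
by case: (unliftP i j) => [k|] ->; rewrite ?insert_rV_eq// insert_rV_lift.
Qed.

Lemma prod_set_generates n :
  measurable = <<s [set prod_set A | A in
    [set A : 'I_n -> set R | forall i, measurable (A i)]] >>.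
Proof.
apply/seteqP; split; last first.
  apply: smallest_sub; first exact: sigma_algebra_measurable.
  by move=> _ [A mA <-]; exact: measurable_prod_set.
apply: smallest_sub; first exact: smallest_sigma_algebra.
move=> B; rewrite -bigcup_seq => -[i _ [C mC <-]].
apply: sub_gen_smallest => /=.
exists (fun j => if j == i then C else setT).
  by move=> j; case: ifP.
rewrite setTI; apply/seteqP; split=> [x /(_ i)|x /= Cx j]; first by rewrite eqxx.
by case: eqP => // ->.
Qed.

Lemma lebesgue_rV_prod_set n (A : 'I_n -> set R) :
  (forall i, measurable (A i)) ->
  lebesgue_rV n (prod_set A) = (\prod_(i < n) mu (A i))%E.
Proof. exact: lebesgue_rV_box. Qed.

(** Both measures give a product set the product of the lengths of its factors. Product sets are
    stable under intersection and generate the sigma-algebra, and the cubes with sides [-k, k]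
    exhaust the space with finite measure, so the measures coincide. *)
Lemma lebesgue_rV_insert n (i : 'I_n.+1) (X : set 'rV[R]_n.+1) : measurable X ->
  lebesgue_rV n.+1 X =
  pushforward (mu \x lebesgue_rV n)%E (insert_rV i) X.
Proof.
pose m0 : {measure set 'rV[R]_n.+1 -> \bar R} :=
  pushforward (mu \x lebesgue_rV n)%E (insert_rV i).
pose m2 := m0 (measurable_insert_rV i).
move=> mX; transitivity (m2 X) => //.
apply: (measure_unique [set prod_set A | A in
    [set A : 'I_n.+1 -> set R | forall i, measurable (A i)]]
  (fun k => prod_set (fun=> `[- k%:R, k%:R]%classic))) => //.
- exact: prod_set_generates.
- move=> _ _ [A mA <-] [B mB <-]; exists (fun j => A j `&` B j).
    by move=> j; exact: measurableI.
  by apply/seteqP; split => [x AB|x [Ax Bx] j //]; split => j; have [] := AB j.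
- by move=> k; exists (fun=> `[- k%:R, k%:R]%classic).
- rewrite -subTset => x _.
  have [k xk] : exists k : nat, forall j, `|x ord0 j| <= k%:R.
    have /choice[f fP] : forall j, exists k : nat, `|x ord0 j| <= k%:R.
      by move=> j; exists (Num.bound `|x ord0 j|); exact/ltW/archi_boundP.
    exists (\max_j f j) => j.
    by rewrite (le_trans (fP j))// ler_nat leq_bigmax.
  by exists k => // j /=; rewrite in_itv/= -ler_norml.
- move=> _ [A mA <-]; rewrite [LHS]lebesgue_rV_prod_set//.
  rewrite /m2/= /m0/= /pushforward.
  rewrite insert_rV_prod_set product_measure1E; last 2 first.
  - exact: mA.
  - exact: measurable_prod_set.
  rewrite (bigD1_ord i)//=; congr (_ * _)%E.
  by rewrite -lebesgue_rV_prod_set.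
- move=> k; rewrite [X in (X < _)%E]lebesgue_rV_prod_set//.
  have : (\prod_(i < n.+1) mu `[(- k%:R)%R, (k%:R)%R]%classic)%E \is a fin_num.
    elim/big_ind : _ => [//|x y x0 y0|j _]; first exact: fin_numM.
    by rewrite lebesgue_measure_itv/= lte_fin; case: ifP.
  by rewrite ltey_eq => ->.
Qed.

Lemma measurable_slice_rV n (i : 'I_n.+1) (h : 'rV[R]_n.+1 -> \bar R) :
  measurable_fun setT h -> measurable_fun setT (h \o insert_rV i).
Proof.
by move=> mh; apply: measurableT_comp => //; exact: measurable_insert_rV.
Qed.

Lemma ge0_integral_rV_insert n (i : 'I_n.+1) (h : 'rV[R]_n.+1 -> \bar R) :
  measurable_fun setT h -> (forall x, 0 <= h x)%E ->
  (\int[lebesgue_rV n.+1]_x h x =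
   \int[lebesgue_rV n]_w \int[mu]_t h (insert_rV i (t, w)))%E.
Proof.
move=> mh h0.
have mhi := measurable_slice_rV i mh.
pose m0 : {measure set 'rV[R]_n.+1 -> \bar R} :=
  pushforward (mu \x lebesgue_rV n)%E (insert_rV i).
rewrite (eq_measure_integral (m0 (measurable_insert_rV i))); last first.
  by move=> A mA _; exact: lebesgue_rV_insert.
rewrite ge0_integral_pushforward//=; last 1 first.
  exact: measurable_insert_rV.
by rewrite preimage_setT fubini_tonelli2//.
Qed.

Lemma measurable_integral_slice_rV n (i : 'I_n.+1) (h : 'rV[R]_n.+1 -> \bar R) :
  measurable_fun setT h -> (forall x, 0 <= h x)%E ->
  measurable_fun setT (fun w => \int[mu]_t h (insert_rV i (t, w)))%E.
Proof.
move=> mh h0.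
apply: (measurable_fun_fubini_tonelli_G (m1 := mu) (h \o insert_rV i)) => //=.
exact: measurable_slice_rV.
Qed.

(** By Tonelli the measures of the slices of a null set integrate to 0, so almost every slice is
    null. *)
Lemma ae_slice_rV n (i : 'I_n.+1) (P : 'rV[R]_n.+1 -> Prop) :
  {ae lebesgue_rV n.+1, forall x, P x} ->
  {ae lebesgue_rV n, forall w, {ae mu, forall t, P (insert_rV i (t, w))}}.
Proof.
move=> [N [mN N0 PN]].
have mI : measurable_fun setT (fun x => (\1_N x)%:E : \bar R).
  by apply/measurable_EFinP; exact: measurable_indic.
have I0 x : (0 <= (\1_N x)%:E :> \bar R)%E by rewrite lee_fin.
have := ge0_integral_rV_insert i mI I0.
rewrite [X in X = _ -> _](_ : _ = 0%E); last first.
  by rewrite integral_indic// setIT.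
move/esym.
rewrite -(@eq_integral _ _ _ _ _ _ (fun w =>
    `|\int[mu]_t (\1_N (insert_rV i (t, w)))%:E|%E)); last first.
  by move=> w _; rewrite gee0_abs// integral_ge0.
move/(ae_eq_integral_abs _ measurableT (measurable_integral_slice_rV i mI I0)).
rewrite /ae_eq; apply: filterS.
move=> w /= /(_ I) w0.
exists ((fun t => insert_rV i (t, w)) @^-1` N).
have mw : measurable ((fun t => insert_rV i (t, w)) @^-1` N).
  rewrite -[X in measurable X]setTI.
  have : measurable_fun setT (fun t : measurableTypeR R => insert_rV i (t, w)).
    apply: measurableT_comp; first exact: measurable_insert_rV.
    exact: measurable_fun_pair.
  exact.
split => //; last by move=> t /= Pt; exact: PN.
move: w0; under eq_integral do
  rewrite -[\1_N _]/(((\1_N) \o (fun t => insert_rV i (t, w))) _).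
by rewrite (integral_indic _ measurableT mw) setIT.
Qed.

Lemma ge0_integral_prod_set n (i : 'I_n.+1) (A : 'I_n.+1 -> set R)
    (h : 'rV[R]_n.+1 -> \bar R) : (forall j, measurable (A j)) ->
  measurable_fun setT h -> (forall x, 0 <= h x)%E ->
  (\int[lebesgue_rV n.+1]_(x in prod_set A) h x =
   \int[lebesgue_rV n]_(w in prod_set (fun j => A (lift i j)))
     \int[mu]_(t in A i) h (insert_rV i (t, w)))%E.
Proof.
move=> mA mh h0; have mP := measurable_prod_set mA.
rewrite integral_mkcond [RHS]integral_mkcond.
rewrite (ge0_integral_rV_insert i); last 2 first.
- by apply/(measurable_restrictT _ mP); exact: measurable_funTS.
- by move=> x; apply: erestrict_ge0.
apply: eq_integral => w _; rewrite patchE; case: ifPn => wA.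
  rewrite [RHS]integral_mkcond; apply: eq_integral => t _.
  rewrite !patchE; congr (if _ then _ else _).
  apply/idP/idP; rewrite !inE.
    by move=> /(_ i); rewrite insert_rV_eq.
  move=> At j; case: (unliftP i j) => [k|] ->; rewrite ?insert_rV_eq//.
  by rewrite insert_rV_lift; move: wA; rewrite inE; exact.
rewrite integral0_eq// => t _; rewrite patchE ifF//.
apply: contraNF wA; rewrite !inE => Aw j.
by have := Aw (lift i j); rewrite insert_rV_lift.
Qed.

Lemma measurable_integral_slice_in n (i : 'I_n.+1) (I : set R)
    (h : 'rV[R]_n.+1 -> \bar R) : measurable I ->
  measurable_fun setT h -> (forall x, 0 <= h x)%E ->
  measurable_fun setT (fun w => \int[mu]_(t in I) h (insert_rV i (t, w)))%E.
Proof.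
move=> mI mh h0.
pose A (j : 'I_n.+1) : set R := if j == i then I else setT.
have mA j : measurable (A j) by rewrite /A; case: ifP.
have mP := measurable_prod_set mA.
have mhA : measurable_fun setT (h \_ (prod_set A)).
  by apply/(measurable_restrictT _ mP); exact: measurable_funTS.
have hA0 x : (0 <= (h \_ (prod_set A)) x)%E by exact: erestrict_ge0.
apply: eq_measurable_fun (measurable_integral_slice_rV i mhA hA0) => w _.
rewrite [RHS]integral_mkcond; apply: eq_integral => t _.
rewrite !patchE; congr (if _ then _ else _).
apply/idP/idP; rewrite !inE.
  by move=> /(_ i); rewrite insert_rV_eq /A eqxx.
by move=> At j; rewrite /A; case: eqP => // ->; rewrite insert_rV_eq.
Qed.

(* Fubini along coordinate i reduces a change of the i-th side of a box to the
   one-dimensional bound on each slice. *)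
Lemma slice_average_le n (i : 'I_n.+1) (W : set 'rV[R]_n) (I J K : set R)
    (alpha beta : R) (u G : 'rV[R]_n.+1 -> R) :
  measurable W -> measurable I -> measurable J -> measurable K ->
  0 < alpha -> 0 < beta -> mu I = alpha%:E -> mu J = beta%:E ->
  I `<=` K -> J `<=` K ->
  measurable_fun setT u -> (forall x, 0 <= u x) ->
  measurable_fun setT G -> (forall x, 0 <= G x) ->
  {ae lebesgue_rV n, forall w, W w -> forall s t, K s -> K t ->
     ((u (insert_rV i (t, w)) - u (insert_rV i (s, w)))%:E <=
      \int[mu]_(r in K) (G (insert_rV i (r, w)))%:E)%E} ->
  (alpha^-1%:E * \int[lebesgue_rV n]_(w in W)
     \int[mu]_(t in I) (u (insert_rV i (t, w)))%:E <=
   beta^-1%:E * \int[lebesgue_rV n]_(w in W)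
     \int[mu]_(t in J) (u (insert_rV i (t, w)))%:E +
   \int[lebesgue_rV n]_(w in W)
     \int[mu]_(t in K) (G (insert_rV i (t, w)))%:E)%E.
Proof.
move=> mW mI mJ mK a0 b0 Ia Jb IK JK mu0 u0 mG G0 aeH.
have mslice (h : 'rV[R]_n.+1 -> R) (I0 : set R) w : measurable I0 ->
    measurable_fun setT h ->
    measurable_fun I0 (fun t : measurableTypeR R => (h (insert_rV i (t, w)))%:E).
  move=> mI0 mh; apply: measurable_funTS; apply/measurable_EFinP.
  apply: measurableT_comp => //.
  apply: measurableT_comp; first exact: measurable_insert_rV.
  exact: measurable_fun_pair.
have mint (h : 'rV[R]_n.+1 -> R) (I0 : set R) : measurable I0 ->
    measurable_fun setT h -> (forall x, 0 <= h x) ->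
    measurable_fun W (fun w => \int[mu]_(t in I0) (h (insert_rV i (t, w)))%:E)%E.
  move=> mI0 mh h0; apply: measurable_funTS.
  apply: (measurable_integral_slice_in i (h := EFin \o h)) => //.
  exact/measurable_EFinP.
have int0 (h : 'rV[R]_n.+1 -> R) (I0 : set R) w : (forall x, 0 <= h x) ->
    (0 <= \int[mu]_(t in I0) (h (insert_rV i (t, w)))%:E)%E.
  by move=> h0; apply: integral_ge0 => t _; rewrite lee_fin.
have cstE (I0 : set R) r e : measurable I0 -> mu I0 = r%:E ->
    (\int[mu]_(t in I0) e = e * r%:E)%E.
  by move=> mI0 I0r; rewrite [LHS](integral_cst mu mI0 e); congr (_ * _)%E.
have ai0 : 0 <= alpha^-1 by rewrite invr_ge0 ltW.
have bi0 : 0 <= beta^-1 by rewrite invr_ge0 ltW.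
rewrite -!ge0_integralZl//; last 4 first.
- exact: mint.
- by move=> w _; exact: int0.
- exact: mint.
- by move=> w _; exact: int0.
rewrite -ge0_integralD//; last 4 first.
- by move=> w _; rewrite mule_ge0 ?int0.
- by apply: measurable_funeM; exact: mint.
- by move=> w _; exact: int0.
- exact: mint.
apply: ae_ge0_le_integral => //.
- by move=> w _; rewrite mule_ge0 ?int0.
- by apply: measurable_funeM; exact: mint.
- by move=> w _; rewrite adde_ge0 ?mule_ge0 ?int0.
- by apply: emeasurable_funD; [apply: measurable_funeM|]; exact: mint.
apply: filterS aeH => w H Ww; have {}H := H Ww.
set g := (\int[mu]_(t in K) _)%E in H *.
(* If the integral of [G] on the slice is infinite, the right-hand side is infinite too; otherwise
   it is a real constant [c]. *)
have [->|goo] := eqVneq g +oo%E.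
  by rewrite addey ?leey// gt_eqF// (lt_le_trans ltNy0)// mule_ge0// int0.
have g0 : (0 <= g)%E by exact: int0.
have [c gc] : exists c, g = c%:E.
  by exists (fine g); rewrite fineK// ge0_fin_numE// lt_neqAle goo leey.
rewrite gc in H *.
have c0 : 0 <= c by move: g0; rewrite gc.
(* For fixed [t] the pointwise bound is averaged over [s] in [J]; the result is then averaged over
   [t] in [I]. *)
have step t : K t -> ((u (insert_rV i (t, w)))%:E <=
    beta^-1%:E * \int[mu]_(s in J) (u (insert_rV i (s, w)))%:E + c%:E)%E.
  move=> Kt.
  have : (\int[mu]_(s in J) (u (insert_rV i (t, w)))%:E <=
      \int[mu]_(s in J) ((u (insert_rV i (s, w)))%:E + c%:E))%E.
    apply: ge0_le_integral => //.
    - by move=> s _; rewrite lee_fin.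
    - by apply: emeasurable_funD => //; exact: mslice.
    - move=> s Js; have := H s t (JK _ Js) Kt.
      by rewrite -EFinD !lee_fin lerBlDl.
  rewrite ge0_integralD//; last 2 first.
  - by move=> s _; rewrite lee_fin.
  - exact: mslice.
  rewrite !(cstE J beta)//.
  move=> /(lee_wpmul2l (_ : (0 <= beta^-1%:E)%E)) => /(_ bi0).
  rewrite ge0_muleDr//; last 2 first.
  - exact: int0.
  - by rewrite mule_ge0// lee_fin ltW.
  rewrite -!EFinM.
  by rewrite mulrCA mulVf ?gt_eqF// mulr1 mulrCA mulVf ?gt_eqF// mulr1.
have : (\int[mu]_(t in I) (u (insert_rV i (t, w)))%:E <=
    \int[mu]_(t in I) (beta^-1%:E * \int[mu]_(s in J)
      (u (insert_rV i (s, w)))%:E + c%:E))%E.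
  apply: ge0_le_integral => //.
  - by move=> s _; rewrite lee_fin.
  - exact: mslice.
  - by move=> t It; exact/step/IK.
rewrite (cstE I alpha)//.
move=> /(lee_wpmul2l (_ : (0 <= alpha^-1%:E)%E)) => /(_ ai0).
by rewrite muleCA -EFinM mulVf ?gt_eqF// mule1.
Qed.

(** * Comparison of averages over two boxes *)

Definition box n (a b : 'I_n -> R) : set 'rV[R]_n :=
  prod_set (fun j => `[a j, b j]%classic).

Definition box_average n (u : 'rV[R]_n -> R) (a b : 'I_n -> R) : \bar R :=
  (((\prod_j (b j - a j))^-1)%:E *
   \int[lebesgue_rV n]_(x in box a b) (u x)%:E)%E.

Lemma measurable_box n (a b : 'I_n -> R) : measurable (box a b).
Proof. by apply: measurable_prod_set => j; exact: measurable_itv. Qed.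

Lemma sub_box n (a b a' b' : 'I_n -> R) :
  (forall j, a' j <= a j) -> (forall j, b j <= b' j) -> box a b `<=` box a' b'.
Proof.
move=> aa bb x + j => /(_ j) /=.
by rewrite !in_itv/= => /andP[/(le_trans (aa j)) -> /le_trans ->].
Qed.

(** Only side [i] changes, so both averages carry the same factor 1/P, where [P] is the product of
    the other [n] sides. Each of these is at least [m], whence 1/P <= m^-n, and [slice_average_le]
    treats the remaining coordinate. *)
Lemma box_average_step n (u G : 'rV[R]_n.+1 -> R) (i : 'I_n.+1)
    (a b a' b' q q' : 'I_n.+1 -> R) (m : R) : 0 < m ->
  (forall j, [/\ q j <= a j, a j + m <= b j & b j <= q' j]) ->
  (forall j, [/\ q j <= a' j, a' j + m <= b' j & b' j <= q' j]) ->
  (forall j, j != i -> a' j = a j /\ b' j = b j) ->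
  measurable_fun setT u -> (forall x, 0 <= u x) ->
  measurable_fun setT G -> (forall x, 0 <= G x) ->
  {ae lebesgue_rV n, forall w, box (q \o lift i) (q' \o lift i) w ->
    forall s t, q i <= s <= q' i -> q i <= t <= q' i ->
     ((u (insert_rV i (t, w)) - u (insert_rV i (s, w)))%:E <=
      \int[mu]_(r in `[q i, q' i]) (G (insert_rV i (r, w)))%:E)%E} ->
  (box_average u a' b' <= box_average u a b +
    (m ^- n)%:E * \int[lebesgue_rV n.+1]_(x in box q q') (G x)%:E)%E.
Proof.
move=> m0 hab hab' heq mfu u0 mG G0 aeH.
pose P := \prod_(j < n) (b (lift i j) - a (lift i j)).
have PmP : m ^+ n <= P.
  rewrite -[n in _ ^+ n]card_ord -prodr_const; apply: ler_prod => j _.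
  by rewrite ltW//= lerBrDl; have [] := hab (lift i j).
have P0 : 0 < P by rewrite (lt_le_trans _ PmP)// exprn_gt0.
have eqj j : a' (lift i j) = a (lift i j) /\ b' (lift i j) = b (lift i j).
  by apply: heq; rewrite eq_sym neq_lift.
pose W : set 'rV[R]_n := box (a \o lift i) (b \o lift i).
have avgE (c d : 'I_n.+1 -> R) :
    (forall j, c (lift i j) = a (lift i j) /\ d (lift i j) = b (lift i j)) ->
    c i < d i ->
    box_average u c d = (P^-1%:E * ((d i - c i)^-1%:E *
      \int[lebesgue_rV n]_(w in W)
        \int[mu]_(t in `[c i, d i]) (u (insert_rV i (t, w)))%:E))%E.
  move=> cd cdi; rewrite /box_average (bigD1_ord i)//=.
  rewrite (eq_bigr (fun j => b (lift i j) - a (lift i j))); last first.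
    by move=> j _; have [-> ->] := cd j.
  rewrite -/P (ge0_integral_prod_set i (h := EFin \o u)) //; last first.
    exact/measurable_EFinP.
  rewrite invfM mulrC EFinM -muleA; congr (_ * (_ * _))%E.
  rewrite (_ : prod_set _ = W)//.
  apply/seteqP; split => x + j => /(_ j) /=; have [-> ->] := cd j; exact.
have [qa aib bq] := hab i; have [qa' aib' bq'] := hab' i.
have ltab : a i < b i by rewrite (lt_le_trans _ aib)// ltrDl.
have ltab' : a' i < b' i by rewrite (lt_le_trans _ aib')// ltrDl.
rewrite (avgE a b)// (avgE a' b')//.
have WQ : W `<=` box (q \o lift i) (q' \o lift i).
  by apply: sub_box => j /=; have [] := hab (lift i j).
have mW : measurable W by exact: measurable_box.
have PI0 : (0 <= P^-1%:E)%E by rewrite lee_fin invr_ge0 ltW.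
apply: le_trans.
  apply: (lee_wpmul2l PI0); apply: (slice_average_le (J := `[a i, b i]%classic)
    (K := `[q i, q' i]%classic) (beta := b i - a i) (G := G)) => //.
  - by rewrite subr_gt0.
  - by rewrite subr_gt0.
  - by rewrite lebesgue_measure_itv/= lte_fin ltab' EFinB.
  - by rewrite lebesgue_measure_itv/= lte_fin ltab EFinB.
  - by apply: subset_itv; rewrite bnd_simp.
  - by apply: subset_itv; rewrite bnd_simp.
  - apply: filterS aeH => w H Ww s t /=; rewrite !in_itv/=.
    by apply: H; exact: WQ.
have mGi : measurable_fun setT
    (fun w => \int[mu]_(t in `[q i, q' i]) (G (insert_rV i (t, w)))%:E)%E.
  apply: (measurable_integral_slice_in i (h := EFin \o G)) => //.
  exact/measurable_EFinP.
have Gi0 w : (0 <= \int[mu]_(t in `[q i, q' i]) (G (insert_rV i (t, w)))%:E)%E.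
  by apply: integral_ge0 => t _; rewrite lee_fin.
rewrite ge0_muleDr; last 2 first.
- rewrite mule_ge0 ?lee_fin ?invr_ge0 ?subr_ge0 ?(ltW ltab)//.
  by apply: integral_ge0 => w _; apply: integral_ge0 => t _; rewrite lee_fin.
- exact: integral_ge0.
rewrite leeD2l// (ge0_integral_prod_set i (h := EFin \o G))//; last first.
  exact/measurable_EFinP.
apply: lee_pmul => //.
- exact: integral_ge0.
- by rewrite lee_fin lef_pV2// posrE// exprn_gt0.
apply: ge0_subset_integral => //; last exact: measurable_funTS.
exact: measurable_box.
Qed.

(** The sides are exchanged one at a time: the box given by [mix k] has its first [k] sides from the
    new box and the others from the old one. Each of the n+1 exchanges costs m^-n times the integral
    of [G]. *)
Lemma box_average_le n (u G : 'rV[R]_n.+1 -> R)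
    (a b a' b' q q' : 'I_n.+1 -> R) (m : R) : 0 < m ->
  (forall j, [/\ q j <= a j, a j + m <= b j & b j <= q' j]) ->
  (forall j, [/\ q j <= a' j, a' j + m <= b' j & b' j <= q' j]) ->
  measurable_fun setT u -> (forall x, 0 <= u x) ->
  measurable_fun setT G -> (forall x, 0 <= G x) ->
  (forall i, {ae lebesgue_rV n, forall w, box (q \o lift i) (q' \o lift i) w ->
    forall s t, q i <= s <= q' i -> q i <= t <= q' i ->
     ((u (insert_rV i (t, w)) - u (insert_rV i (s, w)))%:E <=
      \int[mu]_(r in `[q i, q' i]) (G (insert_rV i (r, w)))%:E)%E}) ->
  (box_average u a' b' <= box_average u a b +
    (n.+1%:R * m ^- n)%:E *
      \int[lebesgue_rV n.+1]_(x in box q q') (G x)%:E)%E.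
Proof.
move=> m0 hab hab' mfu u0 mG G0 aeH.
pose mix k (c c' : 'I_n.+1 -> R) (j : 'I_n.+1) := if (j < k)%N then c' j else c j.
set g := (\int[lebesgue_rV n.+1]_(x in box q q') _)%E.
have g0 : (0 <= g)%E by apply: integral_ge0 => x _; rewrite lee_fin.
have mm0 : 0 <= m ^- n by rewrite invr_ge0 exprn_ge0// ltW.
have {}H k : (k <= n.+1)%N -> (box_average u (mix k a a') (mix k b b') <=
    box_average u a b + (k%:R * m ^- n)%:E * g)%E.
  elim: k => [_|k IH kn].
    rewrite mul0r mul0e adde0 le_eqVlt; apply/orP; left; apply/eqP.
    by congr (box_average u _ _); apply/funext.
  have hmix l j : [/\ q j <= mix l a a' j, mix l a a' j + m <= mix l b b' j
      & mix l b b' j <= q' j] by rewrite /mix; case: ifP.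
  apply: (le_trans (box_average_step (i := Ordinal kn) m0 (hmix k) (hmix k.+1)
    _ mfu u0 mG G0 (aeH _))).
    by move=> j jk; rewrite /mix ltnS leq_eqVlt (negbTE (_ : j != k :> nat)).
  rewrite -/g -[k.+1%:R]natr1 mulrDl mul1r EFinD ge0_muleDl ?lee_fin ?mulr_ge0//.
  by rewrite addeA leeD2r// IH// ltnW.
apply: le_trans (H n.+1 (leqnn _)).
rewrite le_eqVlt; apply/orP; left; apply/eqP.
by congr (box_average u _ _); apply/funext => j; rewrite /mix ltn_ord.
Qed.

(** * Small cubes and elementary bounds on averages *)

Definition cube n (x : 'rV[R]_n) (r : R) : set 'rV[R]_n :=
  box (fun j => x ord0 j - r) (fun j => x ord0 j + r).

Lemma cubeP n (x y : 'rV[R]_n) (r : R) :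
  cube x r y <-> forall j, `|x ord0 j - y ord0 j| <= r.
Proof.
by split=> + j => /(_ j); rewrite /= in_itv/= distrC ler_distl.
Qed.

(** Dominated convergence on the cubes of radius 1/(k+1): away from the centre, which is a null set,
    the restricted integrands are eventually 0. *)
Lemma cube_integral_small n (x0 : 'rV[R]_n.+1) (h : 'rV[R]_n.+1 -> R)
    (e s1 : R) : measurable_fun setT h -> (forall x, 0 <= h x) ->
  (\int[lebesgue_rV n.+1]_x (h x)%:E < +oo)%E -> 0 < e -> 0 < s1 ->
  exists s, [/\ 0 < s, s <= s1 &
    (\int[lebesgue_rV n.+1]_(x in cube x0 s) (h x)%:E <= e%:E)%E].
Proof.
move=> mh h0 hoo e0 s10.
pose C k := cube x0 k.+1%:R^-1.
have mC k : measurable (C k) by exact: measurable_box.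
pose f_ k := (EFin \o h) \_ (C k).
have mEh : measurable_fun setT (EFin \o h) by exact/measurable_EFinP.
have [|||||_ _ H] := @dominated_convergence _ _ _ (lebesgue_rV n.+1) setT
  measurableT f_ (cst 0%E) (EFin \o h).
- move=> k; apply/(measurable_restrictT _ (mC k)); exact: measurable_funTS.
- exact: measurable_cst.
- exists (prod_set (fun j => [set x0 ord0 j])); split.
  + by apply: measurable_prod_set => j; exact: measurable_set1.
  + rewrite [LHS]lebesgue_rV_prod_set; last by move=> j; exact: measurable_set1.
    by rewrite big_ord_recl [X in (X * _)%E]lebesgue_measure_set1 mul0e.
  move=> x /= H j; apply: contrapT => xj; apply: H => _.
  apply: cvg_near_cst.
  have d0 : 0 < `|x0 ord0 j - x ord0 j|.
    by rewrite normr_gt0 subr_eq0; apply/eqP => /esym.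
  have := near_infty_natSinv_lt (PosNum d0).
  apply: filterS => k /= kd; rewrite /f_ patchE ifF//.
  apply/negP; rewrite inE => /cubeP /(_ j).
  by rewrite leNgt kd.
- apply/integrableP; split => //.
  by under eq_integral do rewrite gee0_abs ?lee_fin//.
- apply: aeW => x k _; rewrite /f_ patchE; case: ifP => _ /=.
    by rewrite lee_fin ger0_norm.
  by rewrite normr0 lee_fin.
rewrite integral0 in H.
have {}H : \forall k \near \oo, (\int[lebesgue_rV n.+1]_x f_ k x < e%:E)%E.
  have : nbhs (0 : \bar R)%E [set y | (y < e%:E)%E].
    apply: open_nbhs_nbhs; split; first exact: open_ereal_lt_ereal.
    by rewrite /= lte_fin.
  exact: H.
have [k [kh ks]] := filter_ex (filterI H (near_infty_natSinv_lt (PosNum s10))).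
exists k.+1%:R^-1; split => //; first exact: ltW.
by rewrite [leLHS]integral_mkcond; exact: ltW.
Qed.

Lemma lebesgue_rV_itv n (a b : 'I_n -> R) : (forall j, a j < b j) ->
  lebesgue_rV n (box a b) = (\prod_j (b j - a j))%:E.
Proof.
move=> ab; rewrite [LHS]lebesgue_rV_prod_set// -prodEFin.
by apply: eq_bigr => j _; rewrite lebesgue_measure_itv/= lte_fin ab.
Qed.

Lemma box_average_ge n (u : 'rV[R]_n -> R) (a b : 'I_n -> R) (c : R) :
  (forall j, a j < b j) -> measurable_fun setT u -> (forall x, 0 <= u x) ->
  0 <= c -> (forall x, box a b x -> c <= u x) ->
  (c%:E <= box_average u a b)%E.
Proof.
move=> ab mfu u0 c0 cu.
have mB : measurable (box a b) by exact: measurable_box.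
have P0 : 0 < \prod_j (b j - a j) by apply: prodr_gt0 => j _; rewrite subr_gt0.
have : (\int[lebesgue_rV n]_(x in box a b) (cst c%:E) x <=
   \int[lebesgue_rV n]_(x in box a b) (u x)%:E)%E.
  apply: ge0_le_integral => //.
  by apply/measurable_EFinP; exact: measurable_funTS.
rewrite integral_cst// [X in (_ * X)%E]lebesgue_rV_itv// /box_average.
move=> /(lee_wpmul2l (_ : (0 <= (\prod_j (b j - a j))^-1%:E)%E)).
move=> /(_ ltac:(by rewrite lee_fin invr_ge0 ltW)); apply: le_trans.
by rewrite -!EFinM mulrCA mulVf ?mulr1// gt_eqF.
Qed.

Lemma box_average_le_cst n (u : 'rV[R]_n -> R) (a b : 'I_n -> R) (c : R) :
  (forall j, a j < b j) -> measurable_fun setT u -> (forall x, 0 <= u x) ->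
  0 <= c -> (forall x, box a b x -> u x <= c) ->
  (box_average u a b <= c%:E)%E.
Proof.
move=> ab mfu u0 c0 cu.
have mB : measurable (box a b) by exact: measurable_box.
have P0 : 0 < \prod_j (b j - a j) by apply: prodr_gt0 => j _; rewrite subr_gt0.
have : (\int[lebesgue_rV n]_(x in box a b) (u x)%:E <=
  \int[lebesgue_rV n]_(x in box a b) (cst c%:E) x)%E.
  apply: ge0_le_integral => //.
  - by move=> x _; rewrite lee_fin.
  - by apply/measurable_EFinP; exact: measurable_funTS.
rewrite integral_cst// [X in (_ * X)%E]lebesgue_rV_itv// /box_average.
move=> /(lee_wpmul2l (_ : (0 <= (\prod_j (b j - a j))^-1%:E)%E)).
move=> /(_ ltac:(by rewrite lee_fin invr_ge0 ltW)) /le_trans; apply.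
by rewrite -!EFinM mulrCA mulVf ?mulr1// gt_eqF.
Qed.

(** * Norm comparisons and the truncated logarithm *)

Lemma rV_norm_le n (x : 'rV[R]_n) (c : R) :
  0 <= c -> (forall j, `|x ord0 j| <= c) -> `|x| <= c.
Proof.
move=> c0 xc; rewrite [leLHS]mx_normrE; apply/bigmax_leP; split => // -[i j] _ /=.
by rewrite (ord1 i).
Qed.

Lemma rV_coord_le n (x : 'rV[R]_n) j : `|x ord0 j| <= `|x|.
Proof.
rewrite [leRHS]mx_normrE.
exact: (le_bigmax _ (fun ij => `|x ij.1 ij.2|) (ord0, j)).
Qed.

Lemma coord_le_enorm n (x : 'rV[R]_n) j : `|x ord0 j| <= enorm x.
Proof.
rewrite -sqrtr_sqr; apply: ler_wsqrtr.
by rewrite (bigD1 j)//= lerDl sumr_ge0// => k _; exact: sqr_ge0.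
Qed.

(* A smooth truncation of - ln |y|: its slope is at most 1 / |y|, and it is
   bounded above. *)
Definition reg_log (d y : R) : R := - (ln (y ^+ 2 + d ^+ 2) / 2).

Lemma is_derive_reg_log (d y : R) : 0 < d ->
  is_derive y 1 (reg_log d) (- (y / (y ^+ 2 + d ^+ 2))).
Proof.
move=> d0.
have p0 : 0 < y ^+ 2 + d ^+ 2 by rewrite ltr_wpDl ?sqr_ge0 ?exprn_gt0.
have dp : is_derive y (1 : R) (fun y => y ^+ 2 + d ^+ 2) (2 * y).
  by apply: is_derive_eq; rewrite /GRing.scale/= ?mulr1 ?expr1; ring.
have dl : is_derive (y ^+ 2 + d ^+ 2) (1 : R) (@ln R) (y ^+ 2 + d ^+ 2)^-1.
  exact: is_derive1_ln.
have dc := @is_derive1_comp R (@ln R) (fun y => y ^+ 2 + d ^+ 2) y _ _ dl dp.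
rewrite (_ : reg_log d = (fun z => (- 2^-1) *:
    (@ln R \o (fun y => y ^+ 2 + d ^+ 2)) z)); last first.
  by apply/funext => z; rewrite /reg_log /GRing.scale/=; ring.
apply: is_derive_eq; rewrite /GRing.scale/=.
by field; rewrite gt_eqF.
Qed.

Lemma continuous_reg_log (d : R) : 0 < d -> continuous (reg_log d).
Proof.
move=> d0 x; apply: differentiable_continuous; apply/derivable1_diffP.
by have [] := is_derive_reg_log x d0.
Qed.

(** The first bound absorbs the factor |f| of the differential inequality, uniformly in [d]. The
    second, which degenerates as [d] tends to 0, makes [reg_log d] Lipschitz. *)
Lemma reg_log_slope (d y : R) : 0 < d ->
  `|- (y / (y ^+ 2 + d ^+ 2))| * `|y| <= 1 /\
  `|- (y / (y ^+ 2 + d ^+ 2))| <= d^-1.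
Proof.
move=> d0.
have p0 : 0 < y ^+ 2 + d ^+ 2 by rewrite ltr_wpDl ?sqr_ge0 ?exprn_gt0.
rewrite normrN normrM normfV (gtr0_norm p0); split.
  rewrite mulrAC ler_pdivrMr// mul1r -expr2 real_normK ?num_real//.
  by rewrite lerDl sqr_ge0.
rewrite ler_pdivrMr// mulrC ler_pdivlMr//.
have -> : y ^+ 2 = `|y| ^+ 2 by rewrite real_normK ?num_real.
have := sqr_ge0 (`|y| - d); nra.
Qed.

Lemma reg_log_lipschitz (d y z : R) : 0 < d ->
  `|reg_log d y - reg_log d z| <= d^-1 * `|y - z|.
Proof.
move=> d0.
wlog zy : y z / z < y.
  move=> H; have [yz|yz|->] := ltgtP y z; [|exact: H|].
    by rewrite distrC [X in _ * X]distrC; exact: H.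
  by rewrite !subrr !normr0 mulr0.
have dt x := is_derive_reg_log x d0.
have cr := continuous_reg_log d0.
have [c _ ->] := MVT zy (fun x _ => dt x) (continuous_subspaceT cr).
by rewrite normrM ler_wpM2r// (reg_log_slope c d0).2.
Qed.

(** * The differential inequality on coordinate lines *)

(** The two difference quotients are the same function, so the identity holds also where the limit
    does not exist and ['D] takes its default value. *)
Lemma derive_insert_rV n (i : 'I_n.+1) (f : 'rV[R]_n.+1 -> R) w (t : R) :
  'D_1 (fun r : R => f (insert_rV i (r, w))) t =
  gradient f (insert_rV i (t, w)) ord0 i.
Proof.
have E (h : R) : insert_rV i (h *: 1 + t, w) =
    h *: delta_mx ord0 i + insert_rV i (t, w).
  apply/rowP => j; rewrite !mxE eqxx /=.
  case: unliftP => [k|] ->; last by rewrite eqxx /GRing.scale/=.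
  by rewrite eq_sym (negbTE (neq_lift _ _)) mulr0 add0r.
rewrite mxE /derive.
apply: (congr1 (fun g : R -> R => lim (g h @[h --> 0^']))).
by apply/funext => h /=; rewrite E.
Qed.

Lemma insert_rV_dist n (i : 'I_n.+1) w (r t : R) :
  `|insert_rV i (r, w) - insert_rV i (t, w)| <= `|r - t|.
Proof.
apply: rV_norm_le => // j; rewrite !mxE.
by case: unliftP => [k|] _ //=; rewrite subrr normr0.
Qed.

Lemma box_insert_rV n (i : 'I_n.+1) (q q' : 'I_n.+1 -> R) w (t : R) :
  box (q \o lift i) (q' \o lift i) w -> q i <= t <= q' i ->
  box q q' (insert_rV i (t, w)).
Proof.
move=> qw qt j; case: (unliftP i j) => [k|] ->.
  by rewrite insert_rV_lift; exact: qw.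
by rewrite insert_rV_eq /= in_itv.
Qed.

(** By the chain rule the derivative of [reg_log d] composed with a slice of [f] is at most |slope|
    |grad f| <= |slope| G |f| <= G, and [lipschitz_dist_le_integral] applies on almost every
    slice. *)
Lemma reg_log_slice_le n (i : 'I_n.+1) (f G : 'rV[R]_n.+1 -> R)
    (q q' : 'I_n.+1 -> R) (L d : R) : 0 < d -> 0 <= L ->
  q i < q' i ->
  (forall x y, box q q' x -> box q q' y -> `|f x - f y| <= L * `|x - y|) ->
  measurable_fun setT G -> (forall x, 0 <= G x) ->
  {ae lebesgue_rV n.+1, forall x, box q q' x ->
     enorm (gradient f x) <= G x * `|f x|} ->
  {ae lebesgue_rV n, forall w, box (q \o lift i) (q' \o lift i) w ->
    forall s t, q i <= s <= q' i -> q i <= t <= q' i ->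
     ((reg_log d (f (insert_rV i (t, w))) -
       reg_log d (f (insert_rV i (s, w))))%:E <=
      \int[mu]_(r in `[q i, q' i]) (G (insert_rV i (r, w)))%:E)%E}.
Proof.
move=> d0 L0 qq' lip mG G0 /(ae_slice_rV i); apply: filterS => w Hw qw s t qs qt.
pose phi r := f (insert_rV i (r, w)).
have lipphi x y : q i <= x <= q' i -> q i <= y <= q' i ->
    `|phi x - phi y| <= L * `|x - y|.
  move=> qx qy; apply: le_trans (lip _ _ _ _) _; try exact: box_insert_rV.
  by rewrite ler_wpM2l// insert_rV_dist.
have := @lipschitz_dist_le_integral R (fun r => reg_log d (phi r))
  (fun r => G (insert_rV i (r, w))) (d^-1 * L) (q i) (q' i).
apply => //.
- move=> x y qx qy; apply: le_trans (reg_log_lipschitz _ _ d0) _.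
  by rewrite -mulrA ler_wpM2l ?invr_ge0 ?(ltW d0)//; exact: lipphi.
- apply: measurableT_comp => //.
  have : measurable_fun setT (fun t : measurableTypeR R => insert_rV i (t, w)).
    apply: measurableT_comp; first exact: measurable_insert_rV.
    exact: measurable_fun_pair.
  exact.
(* The chain rule needs [phi] itself to be derivable, which holds for almost every [r]. *)
have := lipschitz_ae_derivable qq' lipphi.
move: Hw; apply: filterS2.
move=> r Hr dphi qr _.
have qr' : q i <= r <= q' i by move: qr => /andP[/ltW -> /ltW ->].
have {}Hr := Hr (box_insert_rV qw qr').
have dp : is_derive r 1 phi ('D_1 phi r).
  by apply: DeriveDef => //; exact: dphi.
have dt := is_derive_reg_log (phi r) d0.
have dc := @is_derive1_comp R (reg_log d) phi r _ _ dt dp.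
rewrite (_ : 'D_1 _ r =
    - (phi r / (phi r ^+ 2 + d ^+ 2)) * 'D_1 phi r); last first.
  exact: (@derive_val _ _ _ _ _ _ _ dc).
rewrite normrM.
apply: (@le_trans _ _ (`|- (phi r / (phi r ^+ 2 + d ^+ 2))| *
    (G (insert_rV i (r, w)) * `|phi r|))).
  rewrite ler_wpM2l//; apply: le_trans Hr.
  by rewrite derive_insert_rV; exact: coord_le_enorm.
by rewrite mulrCA ler_piMr// (reg_log_slope (phi r) d0).1.
Qed.

(* Stands in for Hoelder's inequality, so that no real powers are needed. *)
Lemma le_affine_power n (a y : R) : 0 < a -> 0 <= y ->
  y <= a + a ^- n * y ^+ n.+1.
Proof.
move=> a0 y0; have an0 : 0 < a ^+ n by rewrite exprn_gt0.
have [ya|/ltW ay] := leP y a.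
  by rewrite (le_trans ya)// lerDl mulr_ge0 ?exprn_ge0// invr_ge0 ltW.
apply: (@le_trans _ _ (a ^- n * y ^+ n.+1)); last by rewrite lerDr ltW.
rewrite mulrC ler_pdivlMr// exprS ler_wpM2l//.
by rewrite lerXn2r// nnegrE// ltW.
Qed.

(** * Growth of averages over dyadic cubes *)

(** [le_affine_power] integrated over the cube, whose volume is (2s)^(n+1). The parameter [a] stays
    free so that it can be scaled like 1/s. *)
Lemma cube_integral_le n (x : 'rV[R]_n.+1) (G : 'rV[R]_n.+1 -> R) (s a e : R) :
  0 < s -> 0 < a -> measurable_fun setT G -> (forall x, 0 <= G x) ->
  (\int[lebesgue_rV n.+1]_(x in cube x s) (G x ^+ n.+1)%:E <= e%:E)%E ->
  (\int[lebesgue_rV n.+1]_(x in cube x s) (G x)%:E <=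
    (a * (2 * s) ^+ n.+1 + a ^- n * e)%:E)%E.
Proof.
move=> s0 a0 mG G0 Ge.
have mC : measurable (cube x s) by exact: measurable_box.
have an0 : 0 <= a ^- n by rewrite invr_ge0 exprn_ge0// ltW.
have mGn : measurable_fun (cube x s) (fun x => (G x ^+ n.+1)%:E).
  by apply/measurable_EFinP; apply: measurable_funX; exact: measurable_funTS.
apply: (@le_trans _ _ (\int[lebesgue_rV n.+1]_(x in cube x s)
    (a%:E + (a ^- n)%:E * (G x ^+ n.+1)%:E))%E).
  apply: ge0_le_integral => //.
  - by move=> y _; rewrite lee_fin.
  - by apply/measurable_EFinP; exact: measurable_funTS.
  - by apply: emeasurable_funD => //; exact: measurable_funeM.
  - by move=> y _; rewrite -EFinM -EFinD lee_fin le_affine_power.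
rewrite ge0_integralD//; last 3 first.
- by move=> y _; rewrite lee_fin ltW.
- by move=> y _; rewrite -EFinM lee_fin mulr_ge0 ?exprn_ge0.
- exact: measurable_funeM.
rewrite ge0_integralZl//; last by move=> y _; rewrite lee_fin exprn_ge0.
rewrite EFinD leeD//; last by rewrite EFinM lee_wpmul2l.
rewrite [leLHS](integral_cst _ mC a%:E) EFinM lee_wpmul2l ?lee_fin ?(ltW a0)//.
rewrite [leLHS]lebesgue_rV_itv; last by move=> j; lra.
rewrite lee_fin (eq_bigr (fun=> 2 * s)) => [|j _]; last by ring.
by rewrite prodr_const card_ord.
Qed.

Lemma sub_cube n (x y : 'rV[R]_n) (r s : R) : `|x - y| + s <= r ->
  cube y s `<=` cube x r.
Proof.
move=> xys z /cubeP yz; apply/cubeP => j.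
apply: le_trans xys; rewrite -[x _ j](subrK (y ord0 j)) -addrA.
apply: (le_trans (ler_normD _ _)); rewrite lerD//.
by have := rV_coord_le (x - y) j; rewrite !mxE.
Qed.

(** The exponent n+1 is the dimension, so the choice a = eps / t makes the cost of a dyadic step
    independent of the scale [t]. *)
Lemma rescale_power n (t eps eta : R) : 0 < t -> 0 < eps ->
  t ^- n * (eps / t * (2 * t) ^+ n.+1 + (eps / t) ^- n * eta) =
  eps * 2 ^+ n.+1 + eps ^- n * eta.
Proof.
move=> t0 e0.
have tn : t ^+ n != 0 by rewrite expf_neq0 ?gt_eqF.
have en : eps ^+ n != 0 by rewrite expf_neq0 ?gt_eqF.
rewrite exprMn expr_div_n [t ^+ n.+1]exprS.
set a := t ^+ n in tn *; set b := eps ^+ n in en *; set c := 2 ^+ n.+1.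
by field; rewrite tn en gt_eqF.
Qed.

Lemma vanish_on_cube n (f G : 'rV[R]_n.+1 -> R) (x0 : 'rV[R]_n.+1)
    (s0 L eps eta : R) : 0 < s0 -> 0 < L -> 0 < eps ->
  n.+1%:R * (eps * 2 ^+ n.+1 + eps ^- n * eta) <= ln 2 / 2 ->
  f x0 = 0 -> measurable_fun (cube x0 s0) f ->
  (forall x y, cube x0 s0 x -> cube x0 s0 y -> `|f x - f y| <= L * `|x - y|) ->
  measurable_fun setT G -> (forall x, 0 <= G x) ->
  (\int[lebesgue_rV n.+1]_(x in cube x0 s0) (G x ^+ n.+1)%:E <= eta%:E)%E ->
  {ae lebesgue_rV n.+1, forall x, cube x0 s0 x ->
     enorm (gradient f x) <= G x * `|f x|} ->
  forall y, `|x0 - y| < s0 -> f y = 0.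
Proof.
move=> s00 L0 eps0 hsmall fx0 mf lip mG G0 Geta aeG y ys0.
apply/eqP; apply: contrapT => /negP fy0.
have mC s : measurable (cube x0 s) by exact: measurable_box.
pose c := `|f y|.
have c0 : 0 < c by rewrite normr_gt0.
(* The first term keeps the cube around [y] inside the large cube; the second lets [f] vary by at
   most c/2 on it, so that |f| >= c/2 there. *)
pose r := Num.min (s0 - `|x0 - y|) (c / (2 * L)).
have r0 : 0 < r by rewrite lt_min subr_gt0 ys0 divr_gt0// mulr_gt0.
have yr : `|x0 - y| + r <= s0 by rewrite addrC -lerBrDr ge_min lexx.
have rs0 : r <= s0 by rewrite (le_trans _ yr)// lerDr.
have cubeC s : 0 <= s -> cube x0 s x0.
  by move=> ? ; apply/cubeP => j; rewrite subrr normr0.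
have cubed s z : 0 <= s -> cube x0 s z -> `|z - x0| <= s.
  by move=> ? /cubeP h; apply: rV_norm_le => // j; rewrite !mxE distrC.
have fle s z : 0 <= s <= s0 -> cube x0 s z -> `|f z| <= L * s.
  move=> /andP[s_ge0 ss0] zs.
  rewrite -[f z]subr0 -fx0.
  apply: (@le_trans _ _ (L * `|z - x0|)).
    apply: lip; last exact/cubeC/ltW.
    by apply: sub_cube zs; rewrite subrr normr0 add0r.
  by rewrite ler_wpM2l ?(ltW L0)// cubed.
have yC : cube x0 s0 y.
  apply: (@sub_cube _ _ y _ 0); first by rewrite addr0 ltW.
  by apply/cubeP => j; rewrite subrr normr0.
have cA z : cube y r z -> c / 2 <= `|f z|.
  move=> zy; have zC : cube x0 s0 z by exact: (sub_cube yr).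
  have : `|f y - f z| <= c / 2.
    apply: (le_trans (lip _ _ yC zC)).
    have yz : `|y - z| <= r.
      move/cubeP : zy => h; apply: rV_norm_le => [|j]; first exact: ltW.
      by rewrite !mxE.
    apply: (@le_trans _ _ (L * (c / (2 * L)))).
      by rewrite ler_wpM2l ?(ltW L0)// (le_trans yz)// ge_min lexx orbT.
    by rewrite le_eqVlt; apply/orP; left; apply/eqP; field; rewrite gt_eqF.
  by have := ler_normB (f y - f z) (- f z); rewrite opprK subrK normrN -/c; lra.
(* On the large cube |f| <= L s0, because f x0 = 0. Hence [B] bounds f^2 + d^2 for every d <= L s0,
   and adding ln B / 2 to the truncated logarithm makes it nonnegative. *)
pose B := 2 * (L * s0) ^+ 2.
have B0 : 0 < B by rewrite mulr_gt0// exprn_gt0// mulr_gt0.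
pose s k := s0 / 2 ^+ k.
have sk0 k : 0 < s k by rewrite divr_gt0// exprn_gt0.
have sS k : s k = 2 * s k.+1 by rewrite /s exprS; field; rewrite expf_neq0.
have sks0 k : s k <= s0.
  by rewrite ler_pdivrMr ?exprn_gt0// ler_peMr ?(ltW s00)// exprn_ege1// ler1n.
pose u (d : R) :=
  (fun x : 'rV[R]_n.+1 => ln B / 2 + reg_log d (f x)) \_ (cube x0 s0).
have uE (d : R) z : cube x0 s0 z -> u d z = ln B / 2 + reg_log d (f z).
  by move=> Cz; rewrite /u patchE mem_set.
have lnle (v w : R) : 0 < v -> v <= w -> ln v <= ln w.
  by move=> v0 vw; rewrite ler_ln ?posrE// (lt_le_trans v0).
have fdle (d : R) k z : 0 < d <= L * s k -> cube x0 (s k) z ->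
    0 < f z ^+ 2 + d ^+ 2 <= 2 * (L * s k) ^+ 2.
  move=> /andP[d0 dk] zk; rewrite ltr_wpDl ?sqr_ge0 ?exprn_gt0//=.
  have fz : `|f z| <= L * s k by rewrite fle// sks0 ltW.
  rewrite mulr_natl mulr2n lerD//.
    rewrite -[f z ^+ 2]real_normK ?num_real// lerXn2r// nnegrE//.
    by rewrite mulr_ge0// ltW.
  by rewrite lerXn2r// nnegrE ?(ltW d0)// mulr_ge0// ltW.
have s0E : s 0%N = s0 by rewrite /s expr0 divr1.
have u0 (d : R) : 0 < d <= L * s0 -> forall z, 0 <= u d z.
  move=> dL z; rewrite /u patchE; case: ifPn => //; rewrite inE -{1}s0E => zC.
  have [|v1 v2] := andP (fdle d _ _ _ zC); first by rewrite s0E.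
  by rewrite /reg_log -mulrBl divr_ge0// subr_ge0 lnle// /B -s0E.
have mfu (d : R) : 0 < d -> measurable_fun setT (u d).
  move=> d0; apply/(measurable_restrictT _ (mC s0)).
  apply: measurable_funD => //; apply: measurableT_comp => //.
  by apply: continuous_measurable_fun; exact: continuous_reg_log.
have slice (d : R) k i : 0 < d -> {ae lebesgue_rV n, forall w,
    box ((fun j => x0 ord0 j - s k) \o lift i)
        ((fun j => x0 ord0 j + s k) \o lift i) w ->
    forall t1 t2, x0 ord0 i - s k <= t1 <= x0 ord0 i + s k ->
      x0 ord0 i - s k <= t2 <= x0 ord0 i + s k ->
    ((u d (insert_rV i (t2, w)) - u d (insert_rV i (t1, w)))%:E <=
     \int[mu]_(r in `[(x0 ord0 i - s k)%R, (x0 ord0 i + s k)%R])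
       (G (insert_rV i (r, w)))%:E)%E}.
  move=> d0.
  have sub : cube x0 (s k) `<=` cube x0 s0.
    by apply: sub_cube; rewrite subrr normr0 add0r.
  have lipk v w : cube x0 (s k) v -> cube x0 (s k) w ->
      `|f v - f w| <= L * `|v - w|.
    by move=> /sub vC /sub wC; exact: lip.
  have aeGk : {ae lebesgue_rV n.+1, forall x, cube x0 (s k) x ->
      enorm (gradient f x) <= G x * `|f x|}.
    by apply: filterS aeG => v Hv /sub; exact: Hv.
  have qq : x0 ord0 i - s k < x0 ord0 i + s k by have := sk0 k; lra.
  have := reg_log_slice_le (i := i) (q := fun j => x0 ord0 j - s k)
    (q' := fun j => x0 ord0 j + s k) d0 (ltW L0) qq lipk mG G0 aeGk.
  apply: filterS => w H qw t1 t2 q1 q2.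
  have uiE t : x0 ord0 i - s k <= t <= x0 ord0 i + s k ->
      u d (insert_rV i (t, w)) = ln B / 2 + reg_log d (f (insert_rV i (t, w))).
    by move=> qt; apply: uE; apply: sub; exact: box_insert_rV.
  rewrite (uiE t2 q2) (uiE t1 q1) [X in X%:E](_ : _ =
    reg_log d (f (insert_rV i (t2, w))) - reg_log d (f (insert_rV i (t1, w)))).
    exact: H.
  by rewrite opprD addrACA subrr add0r.
have Gint a k : 0 < a ->
    (\int[lebesgue_rV n.+1]_(x in cube x0 (s k)) (G x)%:E <=
     (a * (2 * s k) ^+ n.+1 + a ^- n * eta)%:E)%E.
  move=> a0; apply: cube_integral_le => //; apply: le_trans Geta.
  apply: ge0_subset_integral => //.
  - by apply/measurable_EFinP; apply: measurable_funX; exact: measurable_funTS.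
  - by move=> z _; rewrite lee_fin exprn_ge0.
  - by apply: sub_cube; rewrite subrr normr0 add0r.
(* [CA] bounds [u d] on the cube around [y], where |f| >= c/2; the second term of [C] is the cost of
   passing from that cube to the large one, with a = 1. Neither depends on [d]. *)
pose CA := ln B / 2 - ln ((c / 2) ^+ 2) / 2.
pose C := CA + n.+1%:R * (2 * r) ^- n *
  (1 * (2 * s0) ^+ n.+1 + 1 ^- n * eta).
have avg (d : R) k : 0 < d <= L * s0 ->
    (box_average (u d) (fun j => x0 ord0 j - s k)%R
       (fun j => x0 ord0 j + s k)%R <=
     (C + k%:R * (ln 2 / 2))%:E)%E.
  move=> dL; have /andP[d0 _] := dL.
  elim: k => [|k IH].
    have r20 : 0 < 2 * r by rewrite mulr_gt0.
    apply: le_trans (box_average_le (a := fun j => y ord0 j - r)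
      (b := fun j => y ord0 j + r) (q := fun j => x0 ord0 j - s 0%N)
      (q' := fun j => x0 ord0 j + s 0%N) r20 _ _
      (mfu d d0) (u0 d dL) mG G0 (fun i => slice d 0%N i d0)) _.
    - move=> j; have := rV_coord_le (x0 - y) j; rewrite !mxE s0E => h.
      have := le_trans h (ltW ys0); have : `|x0 ord0 j - y ord0 j| + r <= s0.
        by rewrite (le_trans _ yr)// lerD2r.
      rewrite -lerBrDr ler_norml => /andP[h1 h2] _; split; lra.
    - by move=> j; rewrite s0E; split => //; lra.
    rewrite mul0r addr0 EFinD; apply: leeD.
      apply: box_average_le_cst => //.
      - by move=> j; lra.
      - exact: mfu.
      - exact: u0.
      - rewrite subr_ge0 ler_pM2r ?invr_gt0// lnle ?exprn_gt0 ?divr_gt0//.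
        apply: (@le_trans _ _ ((L * s0) ^+ 2)).
          rewrite lerXn2r// ?nnegrE ?divr_ge0 ?(ltW c0) ?mulr_ge0 ?(ltW L0)
            ?(ltW s00)//.
          apply: (@le_trans _ _ `|f y|).
            by rewrite -/c; lra.
          by apply: (fle _ _ _ yC); rewrite lexx ltW.
        by rewrite /B mulr_natl mulr2n lerDl sqr_ge0.
      move=> z zA; rewrite uE; last exact: (sub_cube yr).
      rewrite /reg_log lerD2l lerN2 ler_pM2r ?invr_gt0//.
      rewrite lnle ?exprn_gt0 ?divr_gt0//.
      apply: (@le_trans _ _ (f z ^+ 2)); last by rewrite lerDl sqr_ge0.
      rewrite -[f z ^+ 2]real_normK ?num_real// lerXn2r// ?nnegrE//.
        by rewrite divr_ge0// ltW.
      exact: cA.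
    rewrite [leRHS]EFinM lee_wpmul2l ?lee_fin ?mulr_ge0 ?invr_ge0 ?exprn_ge0
      ?(ltW r20)//.
    by have := Gint 1 0%N ltr01; rewrite s0E.
  (* Both cubes lie in the cube of radius [s k], and the smaller one has side 2 s_(k+1) = s_k, so
     [s k] serves as the lower bound on the sides. *)
  apply: le_trans (box_average_le (a := fun j => x0 ord0 j - s k)
    (b := fun j => x0 ord0 j + s k) (q := fun j => x0 ord0 j - s k)
    (q' := fun j => x0 ord0 j + s k) (sk0 k) _ _
    (mfu d d0) (u0 d dL) mG G0 (fun i => slice d k i d0)) _.
  - by move=> j; have := sk0 k; split => //; lra.
  - by move=> j; have := sk0 k.+1; rewrite (sS k); split; lra.
  rewrite -[k.+1%:R]natr1 mulrDl addrA mul1r EFinD leeD//.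
  have ek0 : 0 < eps / s k by rewrite divr_gt0.
  apply: le_trans (lee_wpmul2l _ (Gint _ k ek0)) _.
    by rewrite lee_fin mulr_ge0 ?invr_ge0 ?exprn_ge0 ?(ltW (sk0 k)).
  rewrite -EFinM lee_fin; apply: le_trans hsmall; rewrite -mulrA ler_wpM2l//.
  by rewrite rescale_power.
have ln20 : 0 < ln 2 :> R by rewrite ln_gt0// ltr1n.
(* [K] is so large that the lower bound K ln 2 on the K-th average exceeds the upper bound C + K (ln
   2) / 2. *)
pose K := Num.bound (`|C| / (ln 2 / 2)).
have CK : C < K%:R * (ln 2 / 2).
  rewrite -ltr_pdivrMr ?divr_gt0//.
  apply: (@le_lt_trans _ _ (`|C| / (ln 2 / 2))).
    by rewrite ler_pM2r ?invr_gt0 ?divr_gt0// ler_norm.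
  by apply: archi_boundP; rewrite divr_ge0// divr_ge0// ltW.
have dK : 0 < L * s K by rewrite mulr_gt0.
have dKL : 0 < L * s K <= L * s0 by rewrite dK ler_wpM2l// ltW.
have : ((K%:R * ln 2)%R%:E <= box_average (u (L * s K)%R)
    (fun j => x0 ord0 j - s K)%R (fun j => x0 ord0 j + s K)%R)%E.
  apply: box_average_ge => //.
  - by move=> j; have := sk0 K; lra.
  - exact: mfu.
  - exact: u0.
  - by rewrite mulr_ge0// ltW.
  move=> z zK; rewrite uE; last by apply: sub_cube zK; rewrite subrr normr0 add0r.
  have [|v1 v2] := andP (fdle (L * s K) K z _ zK); first by rewrite dK lexx.
  (* With d = L s_K, f^2 + d^2 is at most 2 (L s_K)^2 on the K-th cube, which is B / 4^K; half the
     logarithm of the ratio is K ln 2. *)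
  have lnB : ln B = ln (2 * (L * s K) ^+ 2) + ln 2 *+ (K + K).
    rewrite -lnXn// -lnM ?posrE ?mulr_gt0 ?exprn_gt0//.
    have p0 : (2 ^+ K : R) != 0 by rewrite expf_neq0.
    have -> : B = 2 * (L * s K) ^+ 2 * 2 ^+ (K + K); last by [].
    rewrite /B /s exprD; move: (2 ^+ K : R) p0 => p p0.
    by field.
  have := lnle _ _ v1 v2; rewrite /reg_log lnB mulrnDr -mulr_natl; lra.
move=> /le_trans /(_ (avg _ K dKL)); rewrite lee_fin; lra.
Qed.

(** * Vanishing near a zero and propagation by connectedness *)

Lemma locally_lipschitzP n (D : set 'rV[R]_n) (f : 'rV[R]_n -> R) x :
  open D -> locally_lipschitz D f -> D x ->
  exists L e, [/\ 0 < L, 0 < e, ball x e `<=` D &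
    forall y z, ball x e y -> ball x e z -> `|f y - f z| <= L * `|y - z|].
Proof.
move=> oD lipf Dx; have [U Ux lipU] := lipf x Dx.
have : nbhs x (U `&` D) by apply: filterI => //; exact: open_nbhs_nbhs.
move=> /nbhs_ballP[e /= e0 eUD].
(* The Lipschitz property is stated for all sufficiently large constants, so a positive one can be
   chosen. *)
have [L [L0 lipL]] := filter_ex
  (filterI (nbhs_pinfty_gt (num_real (0 : R))) (lipU : nbhs +oo _)).
exists L, e; split => //; first by move=> y /eUD[].
by move=> y z /eUD UDy /eUD UDz; exact: (lipL (y, z)).
Qed.

Lemma locally_lipschitz_continuous n (D : set 'rV[R]_n) (f : 'rV[R]_n -> R) :
  open D -> locally_lipschitz D f -> {in D, continuous f}.
Proof.
move=> oD lipf x; rewrite inE => Dx.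
have [L [e [L0 e0 _ lip]]] := locally_lipschitzP oD lipf Dx.
move=> A /nbhs_ballP[d /= d0 dA]; apply/nbhs_ballP.
exists (Num.min e (d / L)) => [|y xy]; first by rewrite /= lt_min e0 divr_gt0.
have xye : ball x e y by apply: le_ball xy; rewrite ge_min lexx.
apply: dA; apply: (le_lt_trans (lip _ _ (ballxx _ e0) xye)).
rewrite mulrC -ltr_pdivlMr//; move: xy; rewrite mx_norm_ball /ball_/=.
by rewrite lt_min => /andP[].
Qed.

Lemma locally_zero n (D : set 'rV[R]_n.+1) (f V : 'rV[R]_n.+1 -> R) x0 :
  open D -> locally_lipschitz D f -> Lloc n.+1%:R%:E D V ->
  {ae lebesgue_rV n.+1, forall x, D x ->
    enorm (gradient f x) <= V x * `|f x|} ->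
  D x0 -> f x0 = 0 -> \forall y \near x0, f y = 0.
Proof.
move=> oD lipf VL aeV Dx0 fx0.
have [L [e [L0 e0 eD lip]]] := locally_lipschitzP oD lipf Dx0.
have cubeB s : s < e -> cube x0 s `<=` ball x0 e.
  move=> se z /cubeP zs; rewrite mx_norm_ball /ball_/=.
  have s0 : 0 <= e / 2 by rewrite divr_ge0// ltW.
  apply: (@le_lt_trans _ _ (Num.max s (e / 2))); last by rewrite gt_max se; lra.
  apply: rV_norm_le => [|j]; first by rewrite le_max s0 orbT.
  by rewrite !mxE le_max zs.
have cK : compact (cube x0 (e / 2)).
  by apply: rV_compact => j; exact: segment_compact.
have subK : cube x0 (e / 2) `<=` ball x0 e by apply: cubeB; lra.
have [g gL Vg] := VL _ cK (subset_trans subK eD).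
have mg : measurable_fun setT g by move: gL; rewrite inE => /andP[/[!inE]].
(* |g| replaces [V]: it is measurable and nonnegative on the whole space, and dominates [V] almost
   everywhere on the compact cube. *)
pose G x := `|g x|.
have mG : measurable_fun setT G by exact: measurableT_comp.
have Goo : (\int[lebesgue_rV n.+1]_x (G x ^+ n.+1)%:E < +oo)%E.
  have N1 : 1 <= n.+1%:R :> R by rewrite ler1n.
  have /integrableP[_] := Lfun_integrable N1 gL.
  under eq_integral => x _ do
    rewrite powR_mulrn// gee0_abs ?lee_fin ?exprn_ge0//.
  exact.
have ln20 : 0 < ln 2 :> R by rewrite ln_gt0// ltr1n.
(* With these values each of the two terms in the smallness condition of [vanish_on_cube] equals (ln
   2)/4. *)
pose eps : R := ln 2 / (4 * n.+1%:R * 2 ^+ n.+1).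
pose eta : R := eps ^+ n * (ln 2 / (4 * n.+1%:R)).
have N0 : 0 < n.+1%:R :> R by rewrite ltr0n.
have eps0 : 0 < eps by rewrite divr_gt0// !mulr_gt0// exprn_gt0.
have eta0 : 0 < eta by rewrite mulr_gt0 ?exprn_gt0// divr_gt0// mulr_gt0.
have mGn : measurable_fun setT (fun x => G x ^+ n.+1) by exact: measurable_funX.
have Gn0 x : 0 <= G x ^+ n.+1 by apply: exprn_ge0; exact: normr_ge0.
have e20 : 0 < e / 2 by rewrite divr_gt0.
have [s [s0 se sG]] := cube_integral_small x0 mGn Gn0 Goo eta0 e20.
have subs : cube x0 s `<=` cube x0 (e / 2).
  by apply: sub_cube; rewrite subrr normr0 add0r.
have sube := subset_trans subs subK.
apply/nbhs_ballP; exists s => //= y; rewrite mx_norm_ball /ball_/= => ys.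
apply: (vanish_on_cube (G := G) (x0 := x0) (s0 := s) (L := L) (eps := eps)
  (eta := eta)) => //.
- rewrite /eta mulKf ?expf_neq0 ?gt_eqF//.
  rewrite le_eqVlt; apply/orP; left; apply/eqP; rewrite /eps.
  by field; rewrite expf_neq0// gt_eqF.
- have : measurable_fun (ball x0 e) f.
    apply: continuous_measurable_rV; first exact: ball_open.
    move=> z; rewrite inE => /eD Dz.
    exact: (locally_lipschitz_continuous oD lipf (mem_set Dz)).
  by apply: measurable_funS => //; exact: measurable_ball_rV.
- by move=> v w /sube Bv /sube Bw; exact: lip.
- by move=> x; exact: normr_ge0.
apply: filterS (filterI aeV Vg) => x [aV {}Vg] xs.
apply: le_trans (aV (eD _ (sube _ xs))) _.
rewrite Vg; last exact: subs.
apply: ler_wpM2r => //.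
exact: ler_norm.
Qed.

End box_averages.

Theorem corollary1p3 (R : realType) (n : nat) (Omega : set 'rV[R]_n)
    (f V : 'rV[R]_n -> R) :
  open Omega -> connected Omega ->
  locally_lipschitz Omega f ->
  Lloc n%:R%:E Omega V ->
  {ae lebesgue_rV n, forall x, Omega x ->
    enorm (gradient f x) <= V x * `|f x|} ->
  (exists2 x0, Omega x0 & f x0 = 0) ->
  forall x, Omega x -> f x = 0.
Proof.
(* In dimension 0 the space is a single point. *)
case: n Omega f V => [|n] Omega f V oO cO lipf VL aeV [x0 Ox0 fx0].
  by move=> x _; rewrite -fx0; congr f; apply/rowP => -[].
(* The zero set is nonempty, relatively open by [locally_zero] and relatively closed by continuity,
   so it fills the connected set. *)
pose Z := Omega `&` f @^-1` [set 0].
suff <- : Z = Omega by move=> x [].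
apply: cO.
- by exists x0.
- exists Z; last by rewrite /Z setIA setIid.
  rewrite openE => x [Ox fx]; apply: filterI; first exact: open_nbhs_nbhs.
  exact: (locally_zero oO lipf VL aeV Ox fx).
exists (closure Z); first exact: closed_closure.
apply/seteqP; split => [x Zx|x [Ox clx]].
  by split; [case: Zx|exact: subset_closure].
split => //=; apply/eqP; apply: contrapT => /negP fx.
have cf : {for x, continuous f}.
  exact: (locally_lipschitz_continuous oO lipf (mem_set Ox)).
have : nbhs x (f @^-1` [set y | y != 0]).
  by apply: cf; apply: open_nbhs_nbhs; split => //; exact: open_neq.
by move=> /clx[z [[_ /= ->]]]; rewrite eqxx.
Qed.
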